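(* Fix an equation $(f,q,w)$ as in the context with $\prod_{i=0}^{N-1}(1/f_i)>0$. Let $\gamma\in(-\pi,0)\cup(0,\pi)$ and $K=(k_{ij})\in SL(2,\mathbb R)$ with $k_{11}-f_0k_{12}\neq0$. Let $\mathbf T_K=\begin{pmatrix}0&1&0&0\\0&0&-k_{21}&k_{11}\end{pmatrix}$. For $M\in\{K,-K\}$ with entries $m_{ij}$, write $\lambda_j(M)$, $\lambda_j(-M)$, $\lambda_j(e^{i\gamma}M)$, $\lambda_j(\mathbf T_K)$ for the eigenvalues with boundary conditions $[M|-I]$, $[-M|-I]$, $[e^{i\gamma}M|-I]$, $\mathbf T_K$; put $m_j=\min\{\lambda_j(M),\lambda_j(-M)\}$, $M_j=\max\{\lambda_j(M),\lambda_j(-M)\}$; and say $P(M)$ holds if for every $0\le j\le N-1$: $\lambda_j(M)<\lambda_j(e^{i\gamma}M)<\lambda_j(-M)$ for $j$ even and $\lambda_j(-M)<\lambda_j(e^{i\gamma}M)<\lambda_j(M)$ for $j$ odd. Then for each $M\in\{K,-K\}$: (i) if $m_{11}-f_0m_{12}>0$ and $f_0m_{11}>0$: $P(M)$ holds, $\lambda_j(\mathbf T_K)\le m_j$ for $0\le j\le N-1$, and $M_j\le\lambda_{j+1}(\mathbf T_K)$ for $0\le j\le N-2$; (ii) if $m_{11}-f_0m_{12}>0$ and $f_0m_{11}<0$: $P(M)$ holds, $M_j\le\lambda_j(\mathbf T_K)\le m_{j+1}$ for $0\le j\le N-2$, and $M_{N-1}\le\lambda_{N-1}(\mathbf T_K)$;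 (iii) if $f_0m_{12}<0$ and $m_{11}=0$: $P(M)$ holds and $M_j\le\lambda_j(\mathbf T_K)\le m_{j+1}$ for $0\le j\le N-2$.
   Context: Let $N\ge2$ be an integer. An equation is given by real sequences $f=\{f_n\}_{n=0}^N$, $q=\{q_n\}_{n=1}^N$, $w=\{w_n\}_{n=1}^N$ with $f_n\neq0$, $w_n>0$; it is $-\nabla(f_n\Delta y_n)+q_ny_n=\lambda w_ny_n$, $1\le n\le N$, for $y=\{y_n\}_{n=0}^{N+1}$, $\Delta y_n=y_{n+1}-y_n$, $\nabla y_n=y_n-y_{n-1}$. A boundary condition $[A\,|\,B]$ (equivalently the $2\times4$ coefficient matrix $(A,B)$ of rank 2) is $A(y_0,f_0\Delta y_0)^T+B(y_N,f_N\Delta y_N)^T=0$; matrices differing by left multiplication by an invertible $2\times2$ complex matrix give the same condition (so $\mathbf T_{-K}=\mathbf T_K$). $SL(2,\mathbb R)$: real $2\times2$ matrices of determinant 1; $I$ the identity. Eigenvalues ($\lambda$ with a nontrivial solution) are real; multiplicity = dimension of the solution space; counted with multiplicity they are ordered $\lambda_0\le\lambda_1\le\cdots$. *)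

(* Defs.v *)
From HB Require Import structures.
From mathcomp Require Import all_boot all_order all_algebra.
From mathcomp Require Import all_classical all_reals all_analysis.
From mathcomp Require Import complex.
From Stdlib Require Import ClassicalEpsilon.

Unset Printing Implicit Defensive.

Import Order.TTheory GRing.Theory Num.Theory.
Local Open Scope ring_scope.

Section SL.
Context {R : realType}.
Local Notation C := (R[i]).

Definition rc (x : R) : C := Complex x 0.

(* An equation: f = {f_n}_{n=0}^N, q = {q_n}_{n=1}^N, w = {w_n}_{n=1}^N,
   given as functions nat -> R (values outside the index ranges are unused).
   A boundary condition [A | B] is a pair of 2x2 complex matrices. *)

(* Residual of the system "difference equation + boundary condition" at
   y = {y_n}_{n=0}^{N+1} (given as a function nat -> C).
   Row i < N : equation at n = i+1,
     -(f_n Δy_n - f_{n-1} Δy_{n-1}) + q_n y_n - λ w_n y_n;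
   rows N, N+1 : the two rows of A (y_0, f_0Δy_0)^T + B (y_N, f_NΔy_N)^T. *)
Definition sl_resid (N : nat) (f q w : nat -> R) (A B : 'M[C]_2) (lam : C)
    (y : nat -> C) (i : 'I_(N + 2)) : C :=
  let D := fun n => y n.+1 - y n in
  if (i < N)%N then
    let n := i.+1 in
    - (rc (f n) * D n - rc (f n.-1) * D n.-1) + rc (q n) * y n
      - lam * rc (w n) * y n
  else
    let r : 'I_2 := if i == N :> nat then 0 else 1 in
    A r 0 * y 0%N + A r 1 * (rc (f 0%N) * D 0%N)
    + B r 0 * y N + B r 1 * (rc (f N) * D N).

(* Coefficient matrix of the (linear) system in the unknowns y_0,...,y_{N+1}:
   column j is the residual of the j-th standard basis sequence. *)
Definition sl_sysmx (N : nat) (f q w : nat -> R) (A B : 'M[C]_2) (lam : C)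
    : 'M[C]_(N + 2) :=
  \matrix_(i, j) sl_resid N f q w A B lam (fun k => (k == (j : nat))%:R) i.

(* Multiplicity of lam = dimension of the solution space
   {y in C^(N+2) | sysmx *m y = 0}  (row kernel of the transpose). *)
Definition sl_mult (N : nat) (f q w : nat -> R) (A B : 'M[C]_2) (lam : C)
    : nat :=
  \rank (kermx (sl_sysmx N f q w A B lam)^T).

Definition sl_eig_list (N : nat) (f q w : nat -> R) (A B : 'M[C]_2)
    (l : seq R) : Prop :=
  sorted <=%R l /\
  (forall z : C, (0 < sl_mult N f q w A B z)%N -> complex.Im z = 0) /\
  (forall x : R, count_mem x l = sl_mult N f q w A B (rc x)).

Definition sl_eigs (N : nat) (f q w : nat -> R) (A B : 'M[C]_2) : seq R :=
  epsilon (inhabits [::]) (sl_eig_list N f q w A B).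

Definition sl_lam (N : nat) (f q w : nat -> R) (A B : 'M[C]_2) (j : nat) : R :=
  nth 0 (sl_eigs N f q w A B) j.

Definition cmx (M : 'M[R]_2) : 'M[C]_2 := map_mx rc M.

Definition cexpi (g : R) : C := Complex (cos g) (sin g).

Definition TK_A : 'M[C]_2 := \matrix_(i, j) (if (i == 0) && (j == 1) then 1 else 0).
Definition TK_B (K : 'M[R]_2) : 'M[C]_2 :=
  \matrix_(i, j) (if i == 0 then 0 else if j == 0 then rc (- K 1 0) else rc (K 0 0)).

Definition propP (N : nat) (f q w : nat -> R) (M : 'M[R]_2) (g : R) : Prop :=
  forall j : nat, (j <= N.-1)%N ->
    let lM := sl_lam N f q w (cmx M) (-1) j in
    let lmM := sl_lam N f q w (cmx (- M)) (-1) j in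
    let lg := sl_lam N f q w (cexpi g *: cmx M) (-1) j in
    if odd j then lmM < lg < lM else lM < lg < lmM.

End SL.

(* Main.v *)
(** Let Phi(lambda) be the transfer matrix from (y_0, f_0 Δy_0) to
    (y_N, f_N Δy_N), and P = M^-1 Phi, a 2x2 matrix of determinant 1 whose
    entries are polynomials in lambda. The eigenvalues of [alpha M | -I],
    |alpha| = 1, are the zeros of tr P - 2 Re alpha, and those of T_K are the
    zeros of the entry P_21. Lagrange's identity
    P(lambda)^T J P(mu) - J = (lambda - mu) S(lambda, mu), where S(lambda, lambda)
    is positive definite, shows that all these zeros are real, that their
    algebraic and geometric multiplicities agree, and that at the i-th zero mu_i
    of P_21 the trace satisfies |tr P| >= 2 with a sign alternating in i.

    A polynomial with N real zeros that weakly alternates in sign at N (or N - 1)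
    points, with the right sign at -oo, has zeros interlacing these points. This
    compares every [alpha M | -I] with T_K. If x is the j-th zero of
    tr P - 2 cos gamma, interlacing leaves only the values j and j + 1 for the
    number of zeros of tr P -+ 2 below x, and the sign of
    2 cos gamma -+ 2 fixes the parity of that number. *)

Require Import Defs.
From HB Require Import structures.
From mathcomp Require Import all_boot all_order all_algebra.
From mathcomp Require Import all_classical all_reals all_analysis.
From mathcomp Require Import complex.
From Stdlib Require Import ClassicalEpsilon.
From mathcomp Require Import zify ring lra.
Import Order.TTheory GRing.Theory Num.Theory.
Local Open Scope ring_scope.

(** * Interlacing by counting and parity *)

Section Interlacing.
Variable R : realFieldType.
Implicit Types (L mu : seq R) (t : R).

Lemma count_lt_notin L t : t \notin L ->
  count (fun x => x <= t) L = count (fun x => x < t) L.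
Proof.
move=> tL; apply: eq_in_count => x xL /=; rewrite le_eqVlt.
by case: eqP => // xt; rewrite -xt xL in tL.
Qed.

(** The factor x - t is negative exactly for the x counted. *)
Lemma prod_sub_sign L t : t \notin L ->
  0 < (-1) ^+ count (fun x => x < t) L * \prod_(x <- L) (x - t).
Proof.
elim: L => [|x L IH]; first by rewrite big_nil /= mulr1 ltr01.
rewrite inE negb_or => /andP[tx /IH h]; rewrite big_cons /= exprD.
case: (ltgtP x t) tx => // xt _; rewrite ?expr1 ?expr0 ?mul1r; nra.
Qed.

(** If t is in L, the two counts differ, so both parities occur between them; otherwise the counts
    agree and the sign of the product fixes their parity. *)
Lemma prod_sub_parity L t (b : bool) :
  0 <= (-1) ^+ b * \prod_(x <- L) (x - t) ->
  exists n, [/\ odd n = b, (count (fun x => (x < t)%R) L <= n)%N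
               & (n <= count (fun x => (x <= t)%R) L)%N].
Proof.
set c := count _ L; set c' := count _ L => H.
have [tL|tL] := boolP (t \in L).
  have lt_cc : (c < c')%N by rewrite (count_lt_le_mem t L).
  case: (odd c =P b) => [e|ne]; first by exists c; split=> //; apply: ltnW.
  by exists c.+1; split => //=; case: (odd c) b ne {H} => [] [].
exists c; rewrite /c' count_lt_notin //; split => //.
have := prod_sub_sign L t tL; rewrite -/c -signr_odd.
case: (odd c) b H => [] [] //; rewrite ?expr1 ?expr0 !(mul1r, mulN1r); lra.
Qed.

Lemma count_le_lt L t t' : t < t' ->
  (count (fun x => (x <= t)%R) L <= count (fun x => (x < t')%R) L)%N.
Proof. by move=> tt'; apply: sub_count => x /= /le_lt_trans; apply. Qed.

(* For sorted L: L_(i + e - 1) <= mu_i <= L_(i + e). *)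
Definition interlaces (e : bool) mu L := forall i, (i < size mu)%N ->
  (count (fun x => (x < nth 0 mu i)%R) L <= i + e)%N /\
  (i + e <= count (fun x => (x <= nth 0 mu i)%R) L)%N.

(* Each interval [#{L < mu_i}, #{L <= mu_i}] contains a number b_i of the
   parity of i + e; these numbers are nondecreasing and alternate in parity,
   hence increase by at least one, and there is no room for more than one. *)
Lemma alternating_interlaces (e : bool) mu L : sorted <%R mu ->
  (size L <= size mu + e)%N ->
  (forall i, (i < size mu)%N ->
     0 <= (-1) ^+ (i + e) * \prod_(x <- L) (x - nth 0 mu i)) ->
  interlaces e mu L.
Proof.
move=> smu szL sgn.
(* The range condition sits under the existential so that choice yields a function on all of nat. *)
have ex i : exists n, (i < size mu)%N ->
    [/\ odd n = odd (i + e), (count (fun x => (x < nth 0 mu i)%R) L <= n)%N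
      & (n <= count (fun x => (x <= nth 0 mu i)%R) L)%N].
  case: (ltnP i (size mu)) => [ilt|]; last by exists 0%N.
  have [|n hn] := prod_sub_parity L (nth 0 mu i) (odd (i + e)).
    by rewrite signr_odd; exact: sgn.
  by exists n.
have /= [b hb] := boolp.choice ex.
have mono i : (i.+1 < size mu)%N -> (b i < b i.+1)%N.
  move=> i1; have [par1 _ u1] := hb i (ltnW i1); have [par2 l2 _] := hb _ i1.
  have h : (count (fun x => (x <= nth 0 mu i)%R) L
      <= count (fun x => (x < nth 0 mu i.+1)%R) L)%N.
    by apply: count_le_lt; rewrite (sorted_ltn_nth lt_trans) ?inE // ltnW.
  have : odd (b i) != odd (b i.+1) by rewrite par1 par2 addSn /=; case: odd.
  have : (b i <= b i.+1)%N by exact: leq_trans (leq_trans u1 h) l2.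
  by rewrite leq_eqVlt => /orP[/eqP->|//]; rewrite eqxx.
(* In the base case with [e = true], b_0 is odd and hence at least 1. *)
have low i : (i < size mu)%N -> (i + e <= b i)%N.
  elim: i => [|i IH] ilt; last by have := IH (ltnW ilt); have := mono _ ilt; lia.
  have [] := hb 0%N ilt; case: (e) => //= par _ _; rewrite add0n in par *.
  by case: (b 0%N) par.
(* Descending induction from the last index: there b is at most [size L], which exceeds the wanted
   bound by at most one, and parity excludes that excess. *)
have up k : (k < size mu)%N -> (b (size mu - k.+1)%N <= size mu - k.+1 + e)%N.
  elim: k => [|k IH] klt.
    have h : (size mu - 1 < size mu)%N by lia.
    have [par _ u] := hb _ h.
    have : (b (size mu - 1)%N <= size mu - 1 + e + 1)%N.
      apply: leq_trans u _; apply: leq_trans (count_size _ _) _; lia.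
    rewrite leq_eqVlt => /orP[/eqP E|]; last by lia.
    by move: par; rewrite E oddD addbT; case: odd.
  have E : (size mu - k.+1 = (size mu - k.+2).+1)%N by lia.
  have := IH (ltnW klt); rewrite E.
  have /mono : ((size mu - k.+2).+1 < size mu)%N by lia.
  lia.
move=> i ilt; have [_ l u] := hb i ilt.
have -> : (i + e)%N = b i.
  have := up (size mu - i.+1)%N; have -> : (size mu - (size mu - i.+1).+1 = i)%N by lia.
  have := low i ilt; lia.
by [].
Qed.

Lemma interlaces_le_nth e mu L i : sorted <=%R L -> interlaces e mu L ->
  (i < size mu)%N -> (i + e < size L)%N -> nth 0 mu i <= nth 0 L (i + e)%N.
Proof.
by move=> sL il ilt iL; apply: nth_count_ge; rewrite // iL andbT; case: (il i ilt).
Qed.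

Lemma interlaces_nth_le e mu L i j : sorted <=%R L -> interlaces e mu L ->
  (i < size mu)%N -> (j < i + e)%N -> nth 0 L j <= nth 0 mu i.
Proof.
move=> sL il ilt jlt; have [_ h] := il i ilt.
exact: nth_count_le (leq_trans jlt h).
Qed.

(** As L' interlaces mu, x lies between mu_(j-e) and mu_(j+1-e); the counts of L at these two points
    bound its count at x. *)
Lemma interlaces_count (e : bool) mu L L' j :
  sorted <=%R L' -> interlaces e mu L -> interlaces e mu L' ->
  size L = size L' -> (size L' <= size mu + e)%N -> (j < size L')%N ->
  let x := nth 0 L' j in x \notin L ->
  (j <= count (fun y => (y < x)%R) L <= j.+1)%N.
Proof.
move=> sL' il il' szL szmu jlt x xL; apply/andP; split.
  rewrite -count_lt_notin //.
  (* For [e = true] and j = 0 there is no mu_(j-e), but then the lower bound is 0. *)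
  have [->//|jpos] := posnP j.
  have ilt : (j - e < size mu)%N by move: (e) szmu => []; lia.
  have E : (j - e + e = j)%N by move: (e) => []; lia.
  have := il _ ilt; rewrite E => -[_ /leq_trans]; apply.
  apply: sub_count => y /= /le_trans; apply.
  by have := interlaces_le_nth _ _ _ _ sL' il' ilt; rewrite E; apply.
have [ilt|ige] := ltnP (j.+1 - e) (size mu).
  have E : (j.+1 - e + e = j.+1)%N by move: (e) => []; lia.
  have := il _ ilt; rewrite E => -[+ _]; apply: leq_trans.
  apply: sub_count => y /= /lt_le_trans; apply.
  by apply: (interlaces_nth_le e _ _ _ _ sL' il' ilt); rewrite E.
(* Past the last mu, the length of L is already at most size mu + e <= j + 1. *)
apply: leq_trans (count_size _ _) _; rewrite szL; lia.
Qed.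

(* With j <= #{L < x} <= j + 1 the parity of #{L < x}, i.e. the sign of the
   product, decides on which side of x the j-th element of L lies. *)
Lemma interlaces_compare (e : bool) mu L L' j (b : bool) :
  sorted <=%R L -> sorted <=%R L' -> interlaces e mu L -> interlaces e mu L' ->
  size L = size L' -> (size L' <= size mu + e)%N -> (j < size L')%N ->
  let x := nth 0 L' j in 0 < (-1) ^+ b * \prod_(y <- L) (y - x) ->
  if odd j == b then x < nth 0 L j else nth 0 L j < x.
Proof.
move=> sL sL' il il' szL szmu jlt x sgn.
have xL : x \notin L.
  apply/negP => xL; move: sgn; rewrite (big_rem x xL) /= subrr mul0r mulr0.
  by rewrite ltxx.
have /andP[l u] := interlaces_count e mu L L' j sL' il il' szL szmu jlt xL.
have par : odd (count (fun y => y < x) L) = b.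
  have := prod_sub_sign L x xL; rewrite -signr_odd.
  by case: odd b sgn => [] [] //; rewrite ?expr1 ?expr0 !(mul1r, mulN1r); lra.
rewrite -/x in l u par.
case: eqP => [jb|jb].
  apply: nth_count_gt => //; rewrite szL jlt andbT count_lt_notin //.
  move: u; rewrite leq_eqVlt => /orP[/eqP E|//].
  by move: jb; rewrite -par E /=; case: odd.
apply: nth_count_lt => //.
by move: l; rewrite leq_eqVlt => /orP[/eqP E|//]; case: jb; rewrite -par -E.
Qed.

End Interlacing.

(** * Solutions as trajectories and Lagrange's identity *)

Section Trajectory.
Variable A : comNzRingType.
Implicit Types (g q w : nat -> A) (lam mu : A) (u v : A * A).

(* [traj g q w lam u n] is the pair (y_n, f_n Δy_n) of the solution with
   (y_0, f_0 Δy_0) = u, where g = 1/f. *)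
Fixpoint traj g q w lam u n : A * A :=
  if n is m.+1 then
    let p := traj g q w lam u m in
    let y := p.1 + g m * p.2 in (y, p.2 + (q m.+1 - lam * w m.+1) * y)
  else u.

Lemma trajS g q w lam u n : traj g q w lam u n.+1 =
  let p := traj g q w lam u n in
  let y := p.1 + g n * p.2 in (y, p.2 + (q n.+1 - lam * w n.+1) * y).
Proof. by []. Qed.

Definition wronsk u v := u.1 * v.2 - u.2 * v.1.

(** Nothing is conjugated, so the sum stays polynomial in [lam] and [mu] and makes sense over any
    commutative ring. *)
Definition gram g q w lam mu u v n :=
  \sum_(i < n) w i.+1 * (traj g q w lam u i.+1).1 * (traj g q w mu v i.+1).1.

(** In each step the [g] and [q] terms of the Wronskian cancel; only the difference of the spectral
    parameters survives, and the sum telescopes. *)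
Lemma lagrange g q w lam mu u v n :
  wronsk (traj g q w lam u n) (traj g q w mu v n)
  = wronsk u v + (lam - mu) * gram g q w lam mu u v n.
Proof.
rewrite /gram; elim: n => [|n IH]; first by rewrite big_ord0 mulr0 addr0.
rewrite big_ord_recr mulrDr addrA -IH /wronsk !trajS /=; ring.
Qed.

Lemma traj_comb g q w lam a b n :
  traj g q w lam (a, b) n =
  (a * (traj g q w lam (1, 0) n).1 + b * (traj g q w lam (0, 1) n).1,
   a * (traj g q w lam (1, 0) n).2 + b * (traj g q w lam (0, 1) n).2).
Proof.
elim: n => [|n /= ->] /=; first by congr (_, _); ring.
by congr (_, _); ring.
Qed.

End Trajectory.
Arguments wronsk {A}.
Arguments traj {A}.
Arguments gram {A}.

Section Morphism.
Variables (A B : comNzRingType) (h : {rmorphism A -> B}).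
Variables (g q w : nat -> A) (g' q' w' : nat -> B).
Hypotheses (hg : forall i, h (g i) = g' i) (hq : forall i, h (q i) = q' i)
  (hw : forall i, h (w i) = w' i).

(** Serves for polynomial evaluation, the constants in {poly R}, the embedding of R in R[i], and
    conjugation. *)
Lemma traj_morph lam a b n :
  traj g' q' w' (h lam) (h a, h b) n =
  (h (traj g q w lam (a, b) n).1, h (traj g q w lam (a, b) n).2).
Proof.
elim: n => // n IH; rewrite !trajS IH /= !(rmorphB, rmorphD, rmorphM).
by rewrite hg hq hw.
Qed.

Lemma gram_morph lam mu a b c d n :
  gram g' q' w' (h lam) (h mu) (h a, h b) (h c, h d) n =
  h (gram g q w lam mu (a, b) (c, d) n).
Proof.
rewrite rmorph_sum; apply: eq_bigr => i _.
by rewrite !traj_morph /= !rmorphM hw.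
Qed.

End Morphism.

(** * The transfer matrix P = M^-1 Φ and its differences *)

Section Transfer.
Variable A : comNzRingType.
Variables (g q w : nat -> A) (m11 m12 m21 m22 : A) (n : nat).
Hypothesis detM : m11 * m22 - m12 * m21 = 1.
Implicit Types (lam mu : A).

Local Notation phi lam := (traj g q w lam (1, 0) n).
Local Notation psi lam := (traj g q w lam (0, 1) n).

(* The entries of M^-1 Φ(λ), where Φ(λ) maps (y_0, f_0 Δy_0) to
   (y_n, f_n Δy_n). *)
Definition tr11 lam := m22 * (phi lam).1 - m12 * (phi lam).2.
Definition tr12 lam := m22 * (psi lam).1 - m12 * (psi lam).2.
Definition tr21 lam := m11 * (phi lam).2 - m21 * (phi lam).1.
Definition tr22 lam := m11 * (psi lam).2 - m21 * (psi lam).1.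
Definition discr lam := tr11 lam + tr22 lam.

Local Notation S11 lam mu := (gram g q w lam mu (1, 0) (1, 0) n).
Local Notation S12 lam mu := (gram g q w lam mu (1, 0) (0, 1) n).
Local Notation S21 lam mu := (gram g q w lam mu (0, 1) (1, 0) n).
Local Notation S22 lam mu := (gram g q w lam mu (0, 1) (0, 1) n).


(** M^-1 has determinant 1 and therefore preserves the Wronskian. *)
Lemma transfer_wronsk (u v : A * A) :
  (m22 * u.1 - m12 * u.2) * (m11 * v.2 - m21 * v.1)
  - (m11 * u.2 - m21 * u.1) * (m22 * v.1 - m12 * v.2) = wronsk u v.
Proof. by rewrite -[RHS]mul1r -detM /wronsk; ring. Qed.

(** This and the next three lemmas are the entries of P(lam)^T J P(mu) - J = (lam - mu) S(lam,
    mu). *)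
Lemma transfer_lagrange11 lam mu :
  tr11 lam * tr21 mu - tr21 lam * tr11 mu = (lam - mu) * S11 lam mu.
Proof. by rewrite transfer_wronsk lagrange /wronsk /=; ring. Qed.

Lemma transfer_lagrange12 lam mu :
  tr11 lam * tr22 mu - tr21 lam * tr12 mu = 1 + (lam - mu) * S12 lam mu.
Proof. by rewrite transfer_wronsk lagrange /wronsk /=; ring. Qed.

Lemma transfer_lagrange21 lam mu :
  tr12 lam * tr21 mu - tr22 lam * tr11 mu = - 1 + (lam - mu) * S21 lam mu.
Proof. by rewrite transfer_wronsk lagrange /wronsk /=; ring. Qed.

Lemma transfer_lagrange22 lam mu :
  tr12 lam * tr22 mu - tr22 lam * tr12 mu = (lam - mu) * S22 lam mu.
Proof. by rewrite transfer_wronsk lagrange /wronsk /=; ring. Qed.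

Lemma transfer_det lam : tr11 lam * tr22 lam - tr21 lam * tr12 lam = 1.
Proof. by rewrite transfer_lagrange12 subrr mul0r addr0. Qed.

(** Lagrange's identity is linear in P(mu), and det P(lam) = 1 lets Cramer's rule solve it. The
    factor lam - mu comes out without division, so the formula also holds for polynomials, where it
    yields derivatives. *)
Lemma tr21_sub lam mu : tr21 mu - tr21 lam =
  (lam - mu) * (tr22 lam * S11 lam mu - tr21 lam * S21 lam mu).
Proof.
transitivity (tr22 lam * ((lam - mu) * S11 lam mu)
  - tr21 lam * (- 1 + (lam - mu) * S21 lam mu) - tr21 lam); last by ring.
rewrite -transfer_lagrange11 -transfer_lagrange21 -[tr21 mu in LHS]mul1r.
by rewrite -(transfer_det lam); ring.
Qed.

Lemma tr11_sub lam mu : tr11 mu - tr11 lam =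
  (lam - mu) * (tr12 lam * S11 lam mu - tr11 lam * S21 lam mu).
Proof.
transitivity (tr12 lam * ((lam - mu) * S11 lam mu)
  - tr11 lam * (- 1 + (lam - mu) * S21 lam mu) - tr11 lam); last by ring.
rewrite -transfer_lagrange11 -transfer_lagrange21 -[tr11 mu in LHS]mul1r.
by rewrite -(transfer_det lam); ring.
Qed.

Lemma tr22_sub lam mu : tr22 mu - tr22 lam =
  (lam - mu) * (tr22 lam * S12 lam mu - tr21 lam * S22 lam mu).
Proof.
transitivity (tr22 lam * (1 + (lam - mu) * S12 lam mu)
  - tr21 lam * ((lam - mu) * S22 lam mu) - tr22 lam); last by ring.
rewrite -transfer_lagrange12 -transfer_lagrange22 -[tr22 mu in LHS]mul1r.
by rewrite -(transfer_det lam); ring.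
Qed.

Lemma tr12_sub lam mu : tr12 mu - tr12 lam =
  (lam - mu) * (tr12 lam * S12 lam mu - tr11 lam * S22 lam mu).
Proof.
transitivity (tr12 lam * (1 + (lam - mu) * S12 lam mu)
  - tr11 lam * ((lam - mu) * S22 lam mu) - tr12 lam); last by ring.
rewrite -transfer_lagrange12 -transfer_lagrange22 -[tr12 mu in LHS]mul1r.
by rewrite -(transfer_det lam); ring.
Qed.

(** At mu = lam the second factor is minus the derivative of the trace. *)
Lemma discr_sub lam mu : discr mu - discr lam = (lam - mu) *
  (tr12 lam * S11 lam mu - tr11 lam * S21 lam mu
   + (tr22 lam * S12 lam mu - tr21 lam * S22 lam mu)).
Proof. by rewrite mulrDr -tr11_sub -tr22_sub /discr; ring. Qed.

End Transfer.
Arguments tr11 {A}. Arguments tr12 {A}. Arguments tr21 {A}. Arguments tr22 {A}.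
Arguments discr {A}.

Section TransferMorphism.
Variables (A B : comNzRingType) (h : {rmorphism A -> B}).
Variables (g q w : nat -> A) (g' q' w' : nat -> B).
Hypotheses (hg : forall i, h (g i) = g' i) (hq : forall i, h (q i) = q' i)
  (hw : forall i, h (w i) = w' i).
Variables (lam : A) (n : nat).

Let phi_morph : traj g' q' w' (h lam) (1, 0) n =
  (h (traj g q w lam (1, 0) n).1, h (traj g q w lam (1, 0) n).2).
Proof. by rewrite -(traj_morph _ _ _ _ _ _ _ _ _ hg hq hw) rmorph1 rmorph0. Qed.

Let psi_morph : traj g' q' w' (h lam) (0, 1) n =
  (h (traj g q w lam (0, 1) n).1, h (traj g q w lam (0, 1) n).2).
Proof. by rewrite -(traj_morph _ _ _ _ _ _ _ _ _ hg hq hw) rmorph1 rmorph0. Qed.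

Lemma tr11_morph a b :
  tr11 g' q' w' (h a) (h b) n (h lam) = h (tr11 g q w a b n lam).
Proof. by rewrite /tr11 phi_morph /= rmorphB !rmorphM. Qed.

Lemma tr12_morph a b :
  tr12 g' q' w' (h a) (h b) n (h lam) = h (tr12 g q w a b n lam).
Proof. by rewrite /tr12 psi_morph /= rmorphB !rmorphM. Qed.

Lemma tr21_morph a b :
  tr21 g' q' w' (h a) (h b) n (h lam) = h (tr21 g q w a b n lam).
Proof. by rewrite /tr21 phi_morph /= rmorphB !rmorphM. Qed.

Lemma tr22_morph a b :
  tr22 g' q' w' (h a) (h b) n (h lam) = h (tr22 g q w a b n lam).
Proof. by rewrite /tr22 psi_morph /= rmorphB !rmorphM. Qed.

Lemma discr_morph a b c d :
  discr g' q' w' (h a) (h b) (h c) (h d) n (h lam)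
  = h (discr g q w a b c d n lam).
Proof. by rewrite rmorphD -tr11_morph -tr22_morph. Qed.

End TransferMorphism.

(** Second-order expansion at a point where P = eps I. There tr P(mu) - 2 eps = eps d (S12 - S21)
    with d = lam - mu, and det P(mu) = 1 becomes d (S12 - S21 + d det S) = 0; cancelling d replaces
    S12 - S21 by -d det S. *)
Lemma discr_scalar (A : idomainType) (g q w : nat -> A)
    (m11 m12 m21 m22 eps : A) n lam mu :
  m11 * m22 - m12 * m21 = 1 -> lam != mu -> eps ^+ 2 = 1 ->
  tr11 g q w m12 m22 n lam = eps -> tr22 g q w m11 m21 n lam = eps ->
  tr12 g q w m12 m22 n lam = 0 -> tr21 g q w m11 m21 n lam = 0 ->
  let S u v := gram g q w lam mu u v n in
  discr g q w m11 m12 m21 m22 n mu - eps *+ 2 =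
  - eps * (lam - mu) ^+ 2 *
    (S (1, 0) (1, 0) * S (0, 1) (0, 1) - S (1, 0) (0, 1) * S (0, 1) (1, 0)).
Proof.
move=> detM neq eps2 e11 e22 e12 e21 S.
have h11 := tr11_sub _ g q w _ _ _ _ n detM lam mu.
have h12 := tr12_sub _ g q w _ _ _ _ n detM lam mu.
have h21 := tr21_sub _ g q w _ _ _ _ n detM lam mu.
have h22 := tr22_sub _ g q w _ _ _ _ n detM lam mu.
have := transfer_det _ g q w _ _ _ _ n detM mu.
rewrite {}e11 {}e12 {}e21 {}e22 in h11 h12 h21 h22.
move: h11 h12 h21 h22; rewrite -!/(S _ _) /discr.
set s11 := S (1, 0) (1, 0); set s12 := S (1, 0) (0, 1).
set s21 := S (0, 1) (1, 0); set s22 := S (0, 1) (0, 1).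
set t11 := tr11 _ _ _ _ _ _ _; set t12 := tr12 _ _ _ _ _ _ _.
set t21 := tr21 _ _ _ _ _ _ _; set t22 := tr22 _ _ _ _ _ _ _.
do 4!move=> /(canRL (subrK _)) ->.
set d := lam - mu => H.
have dn0 : d != 0 by rewrite subr_eq0.
have {}H : d * (s12 - s21 + d * (s11 * s22 - s12 * s21)) = 0.
  transitivity (eps ^+ 2 * (1 + d * (s12 - s21 + d * (s11 * s22 - s12 * s21))) - 1).
    by rewrite eps2; ring.
  by rewrite -[X in _ - X = _]H; ring.
move/eqP: H; rewrite mulf_eq0 (negbTE dn0) /= => /eqP H.
apply/eqP; rewrite -subr_eq0; apply/eqP.
transitivity (eps * d * (s12 - s21 + d * (s11 * s22 - s12 * s21))); first by ring.
by rewrite H mulr0.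
Qed.

(** * Positivity of the Gram matrix *)

(** Once y_1 = 0, the second component at 1 is still b, so y_2 = g_1 b. *)
Lemma traj_eq0 (A : idomainType) (g q w : nat -> A) lam a b : g 1%N != 0 ->
  (traj g q w lam (a, b) 1).1 = 0 -> (traj g q w lam (a, b) 2).1 = 0 ->
  a = 0 /\ b = 0.
Proof.
move=> g1 /= y1; rewrite y1 mulr0 addr0 add0r => /eqP.
rewrite mulf_eq0 (negbTE g1) /= => /eqP b0.
by rewrite b0 mulr0 addr0 in y1.
Qed.

Section Positivity.
Variable R : realFieldType.
Variables (g q w : nat -> R) (m11 m12 m21 m22 : R) (N : nat).
Hypotheses (N2 : (2 <= N)%N) (g1 : g 1%N != 0).
Hypothesis wpos : forall n, (1 <= n <= N)%N -> 0 < w n.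
Hypothesis detM : m11 * m22 - m12 * m21 = 1.

Local Notation S x u v := (gram g q w x x u v N).
Local Notation e1 := (1, 0).
Local Notation e2 := (0, 1).

Lemma gram_comb x a b c d : S x (a, b) (c, d) =
  a * c * S x e1 e1 + a * d * S x e1 e2 + b * c * S x e2 e1 + b * d * S x e2 e2.
Proof.
rewrite /gram !mulr_sumr -!big_split /=; apply: eq_bigr => i _.
by rewrite !(traj_comb _ g q w x a b) !(traj_comb _ g q w x c d) /=; ring.
Qed.

Lemma gram_sym x u v : S x u v = S x v u.
Proof. by apply: eq_bigr => i _; ring. Qed.

(** A positively weighted sum of squares; if it vanished then y_1 = y_2 = 0, where N >= 2 enters. *)
Lemma gram_gt0 x a b : ~ (a = 0 /\ b = 0) -> 0 < S x (a, b) (a, b).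
Proof.
move=> ab.
have nn (i : 'I_N) : true ->
    0 <= w i.+1 * (traj g q w x (a, b) i.+1).1 * (traj g q w x (a, b) i.+1).1.
  by move=> _; rewrite -mulrA -expr2 mulr_ge0 ?sqr_ge0 // ltW // wpos /=.
rewrite lt_def sumr_ge0 // andbT; apply/eqP => /psumr_eq0P; move/(_ nn) => H.
have z k : (k < N)%N -> (traj g q w x (a, b) k.+1).1 = 0.
  move=> kN; have /eqP := H (Ordinal kN) isT; rewrite -mulrA mulf_eq0 -expr2.
  rewrite sqrf_eq0 gt_eqF ?wpos //= => /eqP //.
by apply: ab; apply: (traj_eq0 _ _ _ _ _ _ _ g1 (z 0%N _) (z 1%N _)); lia.
Qed.

Lemma gram_det_gt0 x :
  0 < S x e1 e1 * S x e2 e2 - S x e1 e2 * S x e2 e1.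
Proof.
have h1 : 0 < S x e1 e1 by apply: gram_gt0 => -[/eqP]; rewrite oner_eq0.
rewrite -(pmulr_rgt0 _ h1).
(* The form S takes the value S11 det S at (-S12, S11). *)
have := gram_gt0 x (- S x e1 e2) (S x e1 e1).
rewrite [S x (_, S x _ _) _]gram_comb (gram_sym x e2 e1).
set s11 := S x e1 e1 in h1 *; set s12 := S x e1 e2; set s22 := S x e2 e2.
have nz : ~ (- s12 = 0 /\ s11 = 0) by move=> [_ h]; rewrite h ltxx in h1.
by move/(_ nz); congr (0 < _); ring.
Qed.

Local Notation a x := (tr11 g q w m12 m22 N x).
Local Notation b x := (tr12 g q w m12 m22 N x).
Local Notation c x := (tr21 g q w m11 m21 N x).
Local Notation d x := (tr22 g q w m11 m21 N x).
Local Notation D x := (discr g q w m11 m12 m21 m22 N x).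

(** The second hypothesis says that tr P has derivative 0 at x. Given this, the form S takes at (a -
    d, 2c) the value (D^2 - 4) S11 <= 0, so definiteness forces c = 0; the vector (2b, d - a) gives
    b = 0 likewise. Then (a - d)^2 = D^2 - 4 <= 0. *)
Lemma transfer_scalar x : (D x) ^+ 2 <= 4 ->
  b x * S x e1 e1 - a x * S x e2 e1 + (d x * S x e1 e2 - c x * S x e2 e2) = 0 ->
  [/\ b x = 0, c x = 0 & a x = d x].
Proof.
have := transfer_det _ g q w _ _ _ _ N detM x; rewrite /discr.
have S11 : 0 < S x e1 e1 by apply: gram_gt0 => -[/eqP]; rewrite oner_eq0.
have S22 : 0 < S x e2 e2 by apply: gram_gt0 => -[_ /eqP]; rewrite oner_eq0.
have := gram_gt0 x (a x - d x) (2 * c x).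
have := gram_gt0 x (2 * b x) (d x - a x).
rewrite [S x (a x - _, _) _]gram_comb [S x (_ * b x, _) _]gram_comb.
rewrite (gram_sym x e2 e1).
move: (a x) (b x) (c x) (d x) (S x e1 e1) (S x e1 e2) (S x e2 e2) S11 S22.
move=> {}a {}b {}c {}d s11 s12 s22 S11 S22 hb hc det D4 E.
have c0 : c = 0.
  apply/eqP; apply: contraT => cn0.
  have : ~ (a - d = 0 /\ 2 * c = 0) by move=> [_ h]; move/eqP: cn0; apply; lra.
  move/hc.
  have -> : (a - d) * (a - d) * s11 + (a - d) * (2 * c) * s12
      + 2 * c * (a - d) * s12 + 2 * c * (2 * c) * s22 =
    - 4 * c * (b * s11 - a * s12 + (d * s12 - c * s22))
    + ((a + d) ^+ 2 - 4 * (a * d - c * b)) * s11 by ring.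
  rewrite E det mulr0 add0r; nra.
have b0 : b = 0.
  apply/eqP; apply: contraT => bn0.
  have : ~ (2 * b = 0 /\ d - a = 0) by move=> [h _]; move/eqP: bn0; apply; lra.
  move/hb.
  have -> : 2 * b * (2 * b) * s11 + 2 * b * (d - a) * s12
      + (d - a) * (2 * b) * s12 + (d - a) * (d - a) * s22 =
    4 * b * (b * s11 - a * s12 + (d * s12 - c * s22))
    + ((a + d) ^+ 2 - 4 * (a * d - c * b)) * s22 by ring.
  rewrite E det mulr0 add0r; nra.
split=> //; apply/eqP; rewrite -subr_eq0 -sqrf_eq0 eq_le sqr_ge0 andbT.
by rewrite b0 in det; nra.
Qed.

End Positivity.

(** * Characteristic polynomials *)

Section CharPoly.
Variable R : fieldType.
Variables (g q w : nat -> R) (m11 m12 m21 m22 : R) (N : nat).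

Local Notation gP := (fun i => (g i)%:P).
Local Notation qP := (fun i => (q i)%:P).
Local Notation wP := (fun i => (w i)%:P).

(** The generic [discr] over {poly R} at 'X, so that the ring identities above become identities of
    polynomials. *)
Definition discr_poly :=
  discr gP qP wP m11%:P m12%:P m21%:P m22%:P N 'X.
Definition tr21_poly := tr21 gP qP wP m11%:P m21%:P N 'X.

(** The morphism [h] covers both real values and complex roots. *)
Lemma horner_map_discr_poly (F : fieldType) (h : {rmorphism R -> F}) z :
  (map_poly h discr_poly).[z] =
  discr (h \o g) (h \o q) (h \o w) (h m11) (h m12) (h m21) (h m22) N z.
Proof.
pose ev := (horner_eval z \o map_poly h : {rmorphism {poly R} -> F}).
have evC c : ev c%:P = h c by rewrite /= map_polyC /horner_eval hornerC.
have evX : ev 'X = z by rewrite /= map_polyX /horner_eval hornerX.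
have := discr_morph _ _ ev gP qP wP (h \o g) (h \o q) (h \o w).
move=> /(_ (fun i => evC (g i)) (fun i => evC (q i)) (fun i => evC (w i))).
by move=> /(_ 'X N m11%:P m12%:P m21%:P m22%:P); rewrite !evC evX.
Qed.

Lemma horner_map_tr21_poly (F : fieldType) (h : {rmorphism R -> F}) z :
  (map_poly h tr21_poly).[z] =
  tr21 (h \o g) (h \o q) (h \o w) (h m11) (h m21) N z.
Proof.
pose ev := (horner_eval z \o map_poly h : {rmorphism {poly R} -> F}).
have evC c : ev c%:P = h c by rewrite /= map_polyC /horner_eval hornerC.
have evX : ev 'X = z by rewrite /= map_polyX /horner_eval hornerX.
have := tr21_morph _ _ ev gP qP wP (h \o g) (h \o q) (h \o w).
move=> /(_ (fun i => evC (g i)) (fun i => evC (q i)) (fun i => evC (w i))).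
by move=> /(_ 'X N m11%:P m21%:P); rewrite !evC evX.
Qed.

Lemma horner_discr_poly x :
  discr_poly.[x] = discr g q w m11 m12 m21 m22 N x.
Proof. by have := horner_map_discr_poly _ idfun x; rewrite map_poly_id. Qed.

Lemma horner_tr21_poly x : tr21_poly.[x] = tr21 g q w m11 m21 N x.
Proof. by have := horner_map_tr21_poly _ idfun x; rewrite map_poly_id. Qed.

(** The coefficient of degree n of y_(n+1) in the spectral parameter, up to the factor y_1 = a + g_0
    b. *)
Definition lead_traj n := \prod_(i < n) (- w i.+1 * g i.+1).

(** y_1 is constant, and every later step multiplies by q - X w and raises the degree by one.
    Coefficients are used in place of degrees because no factor is assumed nonzero here. *)
Lemma coef_traj_poly n a b :
  let y := traj gP qP wP 'X (a%:P, b%:P) n.+1 in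
  [/\ forall j, (n < j)%N -> y.1`_j = 0,
      forall j, (n.+1 < j)%N -> y.2`_j = 0,
      y.1`_n = lead_traj n * (a + g 0%N * b) &
      y.2`_n.+1 = - w n.+1 * (lead_traj n * (a + g 0%N * b))].
Proof.
have step (y1 y2 : {poly R}) k m : (forall j, (m < j)%N -> y1`_j = 0) ->
    (forall j, (m < j)%N -> y2`_j = 0) ->
    let z := y2 + ((q k)%:P - 'X * (w k)%:P) * y1 in
    (forall j, (m.+1 < j)%N -> z`_j = 0) /\ z`_m.+1 = - w k * y1`_m.
  move=> h1 h2 z.
  have zE j : z`_j.+1 = y2`_j.+1 + (q k * y1`_j.+1 - w k * y1`_j).
    by rewrite /z mulrBl -mulrA coefD coefB coefCM coefXM coefCM.
  split=> [[//|j] jm|]; rewrite zE.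
    by rewrite h1 ?h2 ?h1 ?mulr0 ?subr0 ?addr0 //; lia.
  by rewrite h1 ?h2 //; ring.
elim: n => [|n IH]; rewrite trajS.
  rewrite /=; have E : a%:P + (g 0%N)%:P * b%:P = (a + g 0%N * b)%:P.
    by rewrite -polyCM -polyCD.
  have cC (c : R) j : (0 < j)%N -> c%:P`_j = 0 by rewrite coefC; case: j.
  have [s1 s2] := step (a%:P + (g 0%N)%:P * b%:P) b%:P 1%N 0%N
    ltac:(by rewrite E; apply: cC) (cC b).
  rewrite E in s1 s2 *; rewrite s2; split => //; first by apply: cC.
  by rewrite coefC /= /lead_traj big_ord0 mul1r.
  by rewrite coefC /= /lead_traj big_ord0 mul1r.
move: IH; set y := traj _ _ _ _ _ n.+1 => -[z1 z2 l1 l2] /=.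
have yc j : (y.1 + (g n.+1)%:P * y.2)`_j = y.1`_j + g n.+1 * y.2`_j.
  by rewrite coefD coefCM.
have h1 j : (n.+1 < j)%N -> (y.1 + (g n.+1)%:P * y.2)`_j = 0.
  by move=> h; rewrite yc z1 ?z2 ?mulr0 ?addr0 //; lia.
have [s1 s2] := step _ y.2 n.+2 n.+1 h1 z2.
have lE : (y.1 + (g n.+1)%:P * y.2)`_n.+1 = lead_traj n.+1 * (a + g 0%N * b).
  by rewrite yc z1 // l2 /lead_traj big_ord_recr /=; ring.
by split => //; rewrite s2 lE.
Qed.

(** With g_0 = 1/f_0 the last factor is g_0 (m11 - f_0 m12): the quantity assumed nonzero in the
    theorem. *)
Lemma coef_discr_poly n : N = n.+1 ->
  (forall j, (N < j)%N -> discr_poly`_j = 0) /\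
  discr_poly`_N = - w N * lead_traj n * (m11 * g 0%N - m12).
Proof.
move=> Nn; have [p1 p2 p3 p4] := coef_traj_poly n 1 0.
have [s1 s2 s3 s4] := coef_traj_poly n 0 1.
rewrite polyC0 polyC1 -Nn in p1 p2 p3 p4 s1 s2 s3 s4.
have cE j : discr_poly`_j =
   m22 * (traj gP qP wP 'X (1, 0) N).1`_j - m12 * (traj gP qP wP 'X (1, 0) N).2`_j
   + (m11 * (traj gP qP wP 'X (0, 1) N).2`_j - m21 * (traj gP qP wP 'X (0, 1) N).1`_j).
  by rewrite /discr_poly /discr /tr11 /tr22 coefD !coefB !coefCM.
split=> [j jN|].
  have jn := ltnW jN.
  by rewrite cE (p1 _ jn) (p2 _ jN) (s1 _ jn) (s2 _ jN); ring.
have nN := leqnn N.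
by rewrite cE (p1 _ nN) (s1 _ nN) p4 s4; ring.
Qed.

(** The degree drops from N to N - 1 when m11 = 0; this is why the third case of the theorem has one
    decoupled eigenvalue fewer. *)
Lemma coef_tr21_poly n : N = n.+1 ->
  [/\ forall j, (N < j)%N -> tr21_poly`_j = 0,
      tr21_poly`_N = - w N * lead_traj n * m11,
      m11 = 0 -> forall j, (n < j)%N -> tr21_poly`_j = 0 &
      m11 = 0 -> tr21_poly`_n = - m21 * lead_traj n].
Proof.
move=> Nn; have [p1 p2 p3 p4] := coef_traj_poly n 1 0.
rewrite polyC0 polyC1 -Nn in p1 p2 p3 p4.
have cE j : tr21_poly`_j =
   m11 * (traj gP qP wP 'X (1, 0) N).2`_j - m21 * (traj gP qP wP 'X (1, 0) N).1`_j.
  by rewrite /tr21_poly /tr21 coefB !coefCM.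
split=> [j jN||m0 j jn|m0].
- have jn := ltnW jN.
  by rewrite cE (p1 _ jn) (p2 _ jN); ring.
- have nN := leqnn N.
  by rewrite cE (p1 _ nN) p4; ring.
- by rewrite cE p1 ?Nn // m0; ring.
- by rewrite cE p3 m0; ring.
Qed.

Hypothesis detM : m11 * m22 - m12 * m21 = 1.
Variable x : R.
Local Notation e1 := (1, 0).
Local Notation e2 := (0, 1).
Local Notation a := (tr11 g q w m12 m22 N x).
Local Notation b := (tr12 g q w m12 m22 N x).
Local Notation c := (tr21 g q w m11 m21 N x).
Local Notation d := (tr22 g q w m11 m21 N x).
Local Notation S u v := (gram g q w x x u v N).

Let hg i : polyC (g i) = gP i. Proof. by []. Qed.
Let hq i : polyC (q i) = qP i. Proof. by []. Qed.
Let hw i : polyC (w i) = wP i. Proof. by []. Qed.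

Lemma horner_gram_poly (a b c d : R) :
  (gram gP qP wP x%:P 'X (a%:P, b%:P) (c%:P, d%:P) N).[x] =
  gram g q w x x (a, b) (c, d) N.
Proof.
pose ev := (horner_eval x : {rmorphism {poly R} -> R}).
have evC k : ev k%:P = k by rewrite /= /horner_eval hornerC.
have evX : ev 'X = x by rewrite /= /horner_eval hornerX.
have := gram_morph _ _ ev gP qP wP g q w.
move=> /(_ (fun i => evC (g i)) (fun i => evC (q i)) (fun i => evC (w i))).
move=> /(_ x%:P 'X a%:P b%:P c%:P d%:P N).
by rewrite !evC evX => ->.
Qed.

(** r(x) is the derivative of the trace at x; where it is nonzero, the root is simple. *)
Lemma discr_poly_factor :
  exists2 r, discr_poly - (discr g q w m11 m12 m21 m22 N x)%:P = ('X - x%:P) * r &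
  r.[x] = - (b * S e1 e1 - a * S e2 e1 + (d * S e1 e2 - c * S e2 e2)).
Proof.
have detP : m11%:P * m22%:P - m12%:P * m21%:P = 1 :> {poly R}.
  by rewrite -!polyCM -polyCB detM.
have := discr_sub _ gP qP wP _ _ _ _ N detP x%:P 'X.
rewrite (discr_morph _ _ _ _ _ _ _ _ _ hg hq hw).
rewrite (tr11_morph _ _ _ _ _ _ _ _ _ hg hq hw).
rewrite (tr12_morph _ _ _ _ _ _ _ _ _ hg hq hw) (tr21_morph _ _ _ _ _ _ _ _ _ hg hq hw).
rewrite (tr22_morph _ _ _ _ _ _ _ _ _ hg hq hw).
set E := (X in _ = _ * X).
move=> H; exists (- E); first by rewrite H; ring.
rewrite hornerN; congr (- _); rewrite /E -polyC0 -polyC1.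
by rewrite !(hornerD, hornerN, hornerM) !horner_gram_poly !hornerC.
Qed.

(** Where P(x) = eps I the root has order exactly two, since the Gram determinant will be
    positive. *)
Lemma discr_poly_factor2 eps : eps ^+ 2 = 1 -> a = eps -> d = eps -> b = 0 -> c = 0 ->
  exists2 r, discr_poly - (eps *+ 2)%:P = ('X - x%:P) ^+ 2 * r &
  r.[x] = - eps * (S e1 e1 * S e2 e2 - S e1 e2 * S e2 e1).
Proof.
move=> eps2 ea ed eb ec.
have detP : m11%:P * m22%:P - m12%:P * m21%:P = 1 :> {poly R}.
  by rewrite -!polyCM -polyCB detM.
have xX : x%:P != 'X :> {poly R}.
  apply/eqP => /(congr1 (fun p : {poly R} => p`_1)); rewrite coefC coefX /=.
  by move=> /eqP; rewrite eq_sym oner_eq0.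
have epsP : eps%:P ^+ 2 = 1 :> {poly R} by rewrite -rmorphXn /= eps2.
have := discr_scalar _ gP qP wP _ _ _ _ eps%:P N x%:P 'X detP xX epsP.
rewrite (tr11_morph _ _ _ _ _ _ _ _ _ hg hq hw).
rewrite (tr12_morph _ _ _ _ _ _ _ _ _ hg hq hw) (tr21_morph _ _ _ _ _ _ _ _ _ hg hq hw).
rewrite (tr22_morph _ _ _ _ _ _ _ _ _ hg hq hw) ea ed eb ec.
move=> /(_ erefl erefl erefl erefl) /= H.
set E := (X in _ = _ * X) in H.
exists (- eps%:P * E); first by rewrite polyCMn H; ring.
rewrite /E -polyC0 -polyC1.
by rewrite !(hornerD, hornerN, hornerM) !horner_gram_poly !hornerC.
Qed.

(** At a zero of P_21 one has a d = 1, so d is nonzero and, S11 being positive later, the zero is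
    simple. *)
Lemma tr21_poly_factor : c = 0 ->
  exists2 r, tr21_poly = ('X - x%:P) * r & r.[x] = - (d * S e1 e1).
Proof.
move=> c0.
have detP : m11%:P * m22%:P - m12%:P * m21%:P = 1 :> {poly R}.
  by rewrite -!polyCM -polyCB detM.
have := tr21_sub _ gP qP wP _ _ _ _ N detP x%:P 'X.
rewrite (tr21_morph _ _ _ _ _ _ _ _ _ hg hq hw).
rewrite (tr22_morph _ _ _ _ _ _ _ _ _ hg hq hw) c0 mul0r !subr0 => H.
set E := (X in _ = _ * X) in H.
exists (- E); first by rewrite /tr21_poly H; ring.
rewrite hornerN; congr (- _); rewrite /E -polyC0 -polyC1.
by rewrite !(hornerD, hornerN, hornerM) !horner_gram_poly !hornerC.
Qed.

End CharPoly.

(** * Multiplicities through the transfer matrix *)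

Section Multiplicity.
Variables (R : realType) (N : nat) (f q w : nat -> R).
Local Notation C := (R[i]).
Variables (A B : 'M[C]_2) (z : C).
Hypothesis f0 : forall n, (n <= N)%N -> f n != 0.

Lemma sum_ord2 (F : 'I_2 -> C) : \sum_i F i = F 0 + F 1.
Proof.
rewrite !big_ord_recl big_ord0 addr0; congr (_ + F _); exact: val_inj.
Qed.

Lemma rcE (x : R) : rc x = real_complex R x. Proof. by []. Qed.

Local Notation cg := (fun i => rc (f i)^-1).
Local Notation cq := (fun i => rc (q i)).
Local Notation cw := (fun i => rc (w i)).
Local Notation sol u := (traj cg cq cw z u).

Definition transfer_mx : 'M[C]_2 := \matrix_(i, j)
  (let p := sol ((j == 0)%:R, (j == 1)%:R) N in if i == 0 then p.1 else p.2).

Lemma mulmx_sysmx (u : 'rV[C]_(N + 2)) (y : nat -> C) :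
  (forall j : 'I_(N + 2), u 0 j = y j) ->
  u *m (sl_sysmx N f q w A B z)^T = \row_i sl_resid N f q w A B z y i.
Proof.
move=> uy; apply/rowP => i; rewrite !mxE.
(* Pairing with a basis sequence returns y_k; the rest is linearity of the residual in y. *)
have dlt (k : nat) (kN : (k < N + 2)%N) :
    \sum_(j < N + 2) u 0 j * (k == j :> nat)%:R = y k.
  rewrite (bigD1 (Ordinal kN)) //= eqxx mulr1 big1 ?addr0 ?uy // => j jk.
  rewrite (_ : (k == j :> nat) = false) ?mulr0 //; apply/negbTE.
  by apply: contra jk => /eqP e; apply/eqP/val_inj.
under eq_bigr do rewrite !mxE /sl_resid.
rewrite /sl_resid; have iN := ltn_ord i.
case: ltnP => iN'.
  under eq_bigr => j _.
    have -> : forall a b c d d',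
      u 0 j * (- (rc (f i.+1) * (a - b) - rc (f i.+1.-1) * (c - d))
        + rc (q i.+1) * b - z * rc (w i.+1) * d') =
      - rc (f i.+1) * (u 0 j * a) + rc (f i.+1) * (u 0 j * b)
      + rc (f i.+1.-1) * (u 0 j * c) - rc (f i.+1.-1) * (u 0 j * d)
      + rc (q i.+1) * (u 0 j * b) - z * rc (w i.+1) * (u 0 j * d')
      by move=> *; ring.
    over.
  rewrite /= !(big_split, sumrB) /= -!mulr_sumr !sumrN -!mulr_sumr !dlt; try lia.
  by ring.
set r : 'I_2 := if _ then _ else _.
under eq_bigr => j _.
  have -> : forall a b c d,
    u 0 j * (A r 0 * b + A r 1 * (rc (f 0%N) * (a - b))
      + B r 0 * d + B r 1 * (rc (f N) * (c - d))) =
    A r 0 * (u 0 j * b) + A r 1 * rc (f 0%N) * (u 0 j * a)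
    - A r 1 * rc (f 0%N) * (u 0 j * b) + B r 0 * (u 0 j * d)
    + B r 1 * rc (f N) * (u 0 j * c) - B r 1 * rc (f N) * (u 0 j * d)
    by move=> *; ring.
  over.
rewrite !(big_split, sumrB) /= !sumrN -!mulr_sumr !dlt; try lia.
by ring.
Qed.

Lemma rc_fK n : (n <= N)%N -> rc (f n) * cg n = 1.
Proof.
by move=> nN; rewrite !rcE -rmorphM /= mulfV ?rmorph1 // f0.
Qed.

Lemma sol_diff u n : (n <= N)%N ->
  rc (f n) * ((sol u n.+1).1 - (sol u n).1) = (sol u n).2.
Proof.
by move=> nN; rewrite trajS /= addrC addKr mulrA rc_fK // mul1r.
Qed.

Lemma resid_sol a b (i : 'I_(N + 2)) :
  sl_resid N f q w A B z (fun k => (sol (a, b) k).1) i =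
  if (i < N)%N then 0 else
  let r : 'I_2 := if i == N :> nat then 0 else 1 in
  A r 0 * a + A r 1 * b + B r 0 * (sol (a, b) N).1 + B r 1 * (sol (a, b) N).2.
Proof.
rewrite /sl_resid; case: ltnP => iN.
  rewrite sol_diff // sol_diff ?(ltnW iN) // trajS /=.
  by ring.
by rewrite !sol_diff.
Qed.

(** Row k of the system determines f_(k+1) Δy_(k+1) from the data at k. *)
Lemma resid0_sol y : (forall i, sl_resid N f q w A B z y i = 0) ->
  forall k, (k <= N)%N -> (y k, rc (f k) * (y k.+1 - y k)) =
    sol (y 0%N, rc (f 0%N) * (y 1%N - y 0%N)) k.
Proof.
move=> y0; elim=> [//|k IH] kN.
have kN2 : (k < N + 2)%N by lia.
have E := y0 (Ordinal kN2); rewrite /sl_resid /= kN in E.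
rewrite trajS -IH ?(ltnW kN) //=.
have -> : y k + rc (f k)^-1 * (rc (f k) * (y k.+1 - y k)) = y k.+1.
  by rewrite mulrA [_ * rc (f k)]mulrC rc_fK ?(ltnW kN) // mul1r; ring.
congr (_, _); apply/eqP; rewrite -subr_eq0 -oppr_eq0 -E; apply/eqP.
by ring.
Qed.

(** Multiplication by this matrix sends initial data (y_0, f_0 Δy_0) to the solution they
    generate. *)
Definition sol_mx : 'M[C]_(2, N + 2) :=
  \matrix_(i, j) (sol ((i == 0)%:R, (i == 1)%:R) j).1.

Lemma mul_sol_mx (v : 'rV[C]_2) (j : 'I_(N + 2)) :
  (v *m sol_mx) 0 j = (sol (v 0 0, v 0 1) j).1.
Proof.
by rewrite mxE sum_ord2 !mxE (traj_comb _ _ _ _ _ (v 0 0)).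
Qed.

Lemma resid_sol_row (v : 'rV[C]_2) :
  v *m sol_mx *m (sl_sysmx N f q w A B z)^T = 0 <->
  v *m (A + B *m transfer_mx)^T = 0.
Proof.
rewrite (mulmx_sysmx _ (fun k => (sol (v 0 0, v 0 1) k).1)); last first.
  by move=> j; rewrite mul_sol_mx.
have E r : (v *m (A + B *m transfer_mx)^T) 0 r =
    A r 0 * v 0 0 + A r 1 * v 0 1 + B r 0 * (sol (v 0 0, v 0 1) N).1
    + B r 1 * (sol (v 0 0, v 0 1) N).2.
  rewrite mxE sum_ord2 !mxE !sum_ord2 !mxE (traj_comb _ _ _ _ _ (v 0 0)) /=.
  rewrite ?mulr1n ?mulr0n.
  move: (sol (1, 0) N) (sol (0, 1) N) (v 0 0) (v 0 1).
  move: (A r 0) (A r 1) (B r 0) (B r 1).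
  move=> a0 a1 b0 b1 p1 p2 v0 v1.
  by ring.
split=> [H|H].
  apply/rowP => r; rewrite E mxE.
  have rN : (N + r < N + 2)%N by rewrite ltn_add2l.
  (* The boundary rows are those of index N and N + 1. *)
  have rE : (if (N + r == N)%N then 0 else 1) = r :> 'I_2.
    apply: val_inj; case: r {rN} => [[|[|//]] h] /=; rewrite ?addn0 ?eqxx //.
    by rewrite -{2}[N]addn0 eqn_add2l.
  have := congr1 (fun M : 'rV_(N + 2) => M 0 (Ordinal rN)) H.
  rewrite !mxE resid_sol /= ltnNge leq_addr /=.
  by rewrite rE.
apply/rowP => i; rewrite !mxE resid_sol; case: ifP => // _.
by rewrite /= -E H mxE.
Qed.

Lemma sol_mx_free : row_free sol_mx.
Proof.
apply: inj_row_free => v v0.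
have N0 : (0 < N + 2)%N by rewrite addn2.
have N1 : (1 < N + 2)%N by rewrite addn2.
have := mul_sol_mx v (Ordinal N0); have := mul_sol_mx v (Ordinal N1).
rewrite v0 !mxE /= => /esym + /esym e0; rewrite e0 add0r.
move=> /(congr1 (fun t => rc (f 0%N) * t)).
rewrite mulr0 mulrA rc_fK // mul1r => e1.
by apply/rowP => -[[|[|//]] h]; rewrite mxE; [rewrite -[RHS]e0|rewrite -[RHS]e1];
  congr (v _ _); apply: val_inj.
Qed.

(** Solutions of the whole system are the images, under the injective [sol_mx], of the initial data
    killed by A + B Φ. *)
Lemma sl_multE :
  sl_mult N f q w A B z = (2 - \rank (A + B *m transfer_mx)%R)%N.
Proof.
rewrite -(mxrank_tr (A + _)) -mxrank_ker /sl_mult -(mxrankMfree _ sol_mx_free).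
apply: eqmx_rank; apply/andP; split; apply/rV_subP => u.
  move=> /sub_kermxP u0.
  pose y k := if insub k is Some j then u 0 j else 0.
  have uy (j : 'I_(N + 2)) : u 0 j = y j by rewrite /y valK.
  have yr i : sl_resid N f q w A B z y i = 0.
    have := mulmx_sysmx u y uy; rewrite u0 => /rowP/(_ i).
    by rewrite !mxE.
  have ys := resid0_sol y yr.
  pose v := \row_(j < 2) (if j == 0 then y 0%N else rc (f 0%N) * (y 1%N - y 0%N)).
  have uv : u = v *m sol_mx.
    apply/rowP => j; rewrite mul_sol_mx uy !mxE /=.
    have jN := ltn_ord j.
    have [jle|jgt] := leqP j N; first by rewrite -ys.
    (* [resid0_sol] stops at k = N, so y_(N+1) is recovered from y_N and f_N Δy_N. *)
    have -> : (j : nat) = N.+1 by lia.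
    rewrite trajS -ys //= mulrA [_ * rc (f N)]mulrC rc_fK // mul1r; ring.
  rewrite uv; apply: submxMr; apply/sub_kermxP.
  by apply/resid_sol_row; rewrite -uv.
move=> /submxP[d ->]; apply/sub_kermxP.
by rewrite mulmxA; apply/resid_sol_row; rewrite -mulmxA mulmx_ker mulmx0.
Qed.

End Multiplicity.

(** * Coupled and decoupled boundary conditions *)

(** The polynomial splits over R[i]; its roots equal their real parts, and the splitting descends by
    injectivity of the embedding. *)
Lemma real_rooted_split (R : rcfType) (p : {poly R}) : p != 0 ->
  (forall z : R[i], root (map_poly (real_complex R) p) z -> complex.Im z = 0) ->
  exists2 L : seq R, sorted <=%R L & p = lead_coef p *: \prod_(x <- L) ('X - x%:P).
Proof.
move=> p0 im0.
have [r rE] := closed_field_poly_normal (map_poly (real_complex R) p).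
exists (sort <=%R (map (@complex.Re R) r)); first exact: sort_le_sorted.
apply: (map_poly_inj (real_complex R)).
rewrite rE map_polyZ lead_coef_map rmorph_prod; congr (_ *: _).
rewrite (perm_big (map (@complex.Re R) r)) /=; last by rewrite perm_sort.
rewrite big_map; apply: eq_big_seq => z zr.
rewrite rmorphB /= map_polyX map_polyC /=; congr (_ - _%:P).
have : complex.Im z = 0.
  apply: im0; rewrite rE rootZ ?root_prod_XsubC //.
  by rewrite lead_coef_eq0 map_poly_eq0.
by case: z {zr} => a b /= ->.
Qed.

(** Both numbers are the order of x as a root of p. *)
Lemma count_mem_split (F : fieldType) (p r : {poly F}) (a x : F) k (L : seq F) :
  a != 0 -> p = a *: \prod_(y <- L) ('X - y%:P) ->
  p = ('X - x%:P) ^+ k * r -> r.[x] != 0 -> count_mem x L = k.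
Proof.
move=> a0 pL pr rx.
rewrite -mu_prod_XsubC -(@mupMr _ x a%:P) ?mul_polyC -?pL; last by rewrite rootC.
by rewrite pr mupMl // mup_XsubCX eqxx.
Qed.

(** A sorted list is determined by its multiplicities, so the choice operator can only return L. *)
Lemma sl_eigs_unique (R : realType) N (f q w : nat -> R) A B L :
  sl_eig_list N f q w A B L -> sl_eigs N f q w A B = L.
Proof.
move=> hL; have [s1 [_ c1]] := epsilon_spec (inhabits [::]) _ (ex_intro _ L hL).
have [s2 [_ c2]] := hL.
apply: le_sorted_eq => //; apply/allP => x _ /=.
by rewrite [X in X == _]c1 c2.
Qed.

Lemma rank_mx2 (F : fieldType) (T : 'M[F]_2) :
  (2 - \rank T)%N = if T == 0 then 2%N else (\det T == 0 : nat).
Proof.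
case: eqP => [->|/eqP T0]; first by rewrite mxrank0.
have [d0|d0] := eqVneq (\det T) 0.
  have r1 : (0 < \rank T)%N by rewrite lt0n mxrank_eq0.
  have : (\rank T <= 2)%N by exact: rank_leq_row.
  have : ~~ row_free T by rewrite row_free_unit unitmxE d0 unitr0.
  by rewrite /row_free; move: (\rank T) r1 => [|[|[|k]]].
have : row_free T by rewrite row_free_unit unitmxE unitfE.
by move=> /eqP ->.
Qed.

Lemma det_mx2 (F : comNzRingType) (T : 'M[F]_2) :
  \det T = T 0 0 * T 1 1 - T 0 1 * T 1 0.
Proof.
rewrite (expand_det_row _ 0) !big_ord_recl big_ord0 addr0 /cofactor !det_mx11 !mxE.
rewrite /= expr0 expr1 mul1r mulN1r mulrN.
by congr (T _ _ * T _ _ - T _ _ * T _ _); apply: val_inj.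
Qed.

Lemma mx2P (F : Type) (A B : 'M[F]_2) :
  A 0 0 = B 0 0 -> A 0 1 = B 0 1 -> A 1 0 = B 1 0 -> A 1 1 = B 1 1 -> A = B.
Proof.
move=> h00 h01 h10 h11; apply/matrixP.
have o2 (i : 'I_2) : i = 0 \/ i = 1.
  by case: i => [[|[|//]] h]; [left|right]; apply: val_inj.
by move=> i j; case: (o2 i) => ->; case: (o2 j) => ->.
Qed.

Section Boundary.
Variables (R : realType) (N : nat) (f q w : nat -> R).
Local Notation C := (R[i]).
Hypothesis N2 : (2 <= N)%N.
Hypothesis f0 : forall n, (n <= N)%N -> f n != 0.
Hypothesis wpos : forall n, (1 <= n <= N)%N -> 0 < w n.

Local Notation g := (fun i => (f i)^-1).
Local Notation cg := (fun i => rc (f i)^-1).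
Local Notation cq := (fun i => rc (q i)).
Local Notation cw := (fun i => rc (w i)).
Local Notation sol z u := (traj cg cq cw z u).
Local Notation Phi z := (transfer_mx R N f q w z).

Lemma conjc_rc (x : R) : conjc (rc x) = rc x.
Proof. exact: conjc_real. Qed.

Lemma conjc_sol z (a b : C) n :
  sol (conjc z) (conjc a, conjc b) n =
  (conjc (sol z (a, b) n).1, conjc (sol z (a, b) n).2).
Proof. by apply: (traj_morph _ _ conjc) => i; exact: conjc_real. Qed.

(* Lagrange's identity at z and its conjugate: a self-adjoint boundary
   condition makes the boundary terms cancel. *)
Lemma selfadjoint_real z (a b : C) : ~ (a = 0 /\ b = 0) ->
  wronsk (sol z (a, b) N) (sol (conjc z) (conjc a, conjc b) N)
    = wronsk (a, b) (conjc a, conjc b) ->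
  complex.Im z = 0.
Proof.
move=> ab; rewrite lagrange => /eqP; rewrite -subr_eq0 addrC addKr mulf_eq0.
case/orP => [|/eqP].
  rewrite subr_eq0 => /eqP; case: z => x y /= [h].
  by apply/eqP; move: h => /eqP; rewrite -subr_eq0 opprK -mulr2n mulrn_eq0.
(* Remaining case: the Gram sum, here the sum of w |y|^2, is zero, which forces a = b = 0. *)
pose y k := (sol z (a, b) k).1.
have yE k : (sol (conjc z) (conjc a, conjc b) k).1 = conjc (y k).
  by rewrite conjc_sol.
have nn (i : 'I_N) : true -> 0 <= rc (w i.+1) * y i.+1 * conjc (y i.+1).
  move=> _; rewrite -mulrA; case: (y i.+1) => s t.
  have wi : 0 < w i.+1 by apply: wpos => /=.
  have -> : rc (w i.+1) * (Complex s t * conjc (Complex s t))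
      = rc (w i.+1 * (s ^+ 2 + t ^+ 2)).
    by apply/eqP; rewrite eq_complex /=; apply/andP; split; apply/eqP; ring.
  by rewrite lecE /= eqxx /= mulr_ge0 ?(ltW wi) // addr_ge0 ?sqr_ge0.
rewrite /gram; under eq_bigr => i _ do rewrite yE -/(y i.+1).
move=> /psumr_eq0P; move/(_ nn) => H.
have y0 k : (k < N)%N -> y k.+1 = 0.
  move=> kN; have /eqP := H (Ordinal kN) isT; rewrite /= -mulrA !mulf_eq0 conjc_eq0.
  rewrite orbb => /orP[|/eqP//]; rewrite rcE fmorph_eq0 gt_eqF // wpos //.
case: ab; apply: (traj_eq0 _ _ _ _ _ _ _ _ (y0 0%N _) (y0 1%N _)); try lia.
by rewrite rcE fmorph_eq0 invr_eq0 f0 //; lia.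
Qed.

Variable M : 'M[R]_2.
Hypothesis detM : \det M = 1.
Local Notation m11 := (M 0 0).
Local Notation m12 := (M 0 1).
Local Notation m21 := (M 1 0).
Local Notation m22 := (M 1 1).

Let dM : m11 * m22 - m12 * m21 = 1. Proof. by rewrite -det_mx2. Qed.

Lemma Phi_entries z :
  [/\ Phi z 0 0 = (sol z (1, 0) N).1, Phi z 1 0 = (sol z (1, 0) N).2,
      Phi z 0 1 = (sol z (0, 1) N).1 & Phi z 1 1 = (sol z (0, 1) N).2].
Proof. by rewrite !mxE. Qed.

Local Notation cdiscr z :=
  (discr cg cq cw (rc m11) (rc m12) (rc m21) (rc m22) N z).

Lemma kernel_vector (T : 'M[C]_2) : \det T = 0 ->
  exists a b : C, [/\ ~ (a = 0 /\ b = 0), T 0 0 * a + T 0 1 * b = 0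
    & T 1 0 * a + T 1 1 * b = 0].
Proof.
rewrite -det_tr => /eqP/det0P[v v0 vT]; exists (v 0 0), (v 0 1); split.
- move=> [h0 h1]; case/eqP: v0; apply/rowP => i; rewrite mxE.
  by case: i => [[|[|//]] h]; [rewrite -[RHS]h0 | rewrite -[RHS]h1];
    congr (v _ _); apply: val_inj.
- have /rowP/(_ 0) := vT; rewrite !mxE sum_ord2 !mxE => <-; ring.
- have /rowP/(_ 1) := vT; rewrite !mxE sum_ord2 !mxE => <-; ring.
Qed.

(** * Coupled conditions [α M | -I] with |α| = 1 *)

Section Coupled.
Variables ar ai : R.
Hypothesis norm1 : ar ^+ 2 + ai ^+ 2 = 1.
Local Notation al := (Complex ar ai).

Local Notation T z := (al *: cmx M + (-1 : 'M[C]_2) *m Phi z).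

Lemma coupled_entry z i j : T z i j = al * rc (M i j) - Phi z i j.
Proof. by rewrite mulNmx -idmxE mul1mx !mxE. Qed.

Lemma unit_mul_conj : al * conjc al = 1.
Proof.
apply/eqP; rewrite eq_complex /=; apply/andP; split; apply/eqP.
  by rewrite -[RHS]norm1; ring.
by ring.
Qed.

(** det(α M - Φ) = α^2 - α tr(M^-1 Φ) + 1, and |α| = 1 gives α^2 + 1 = α (2 Re α). *)
Lemma det_coupled z : \det (T z) = al * (rc (2 * ar) - cdiscr z).
Proof.
have detC : rc m11 * rc m22 - rc m12 * rc m21 = 1.
  by rewrite !rcE -!rmorphM -rmorphB /= dM rmorph1.
have detPhi : Phi z 0 0 * Phi z 1 1 - Phi z 1 0 * Phi z 0 1 = 1.
  have [-> -> -> ->] := Phi_entries z.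
  have := lagrange _ cg cq cw z z (1, 0) (0, 1) N.
  by rewrite subrr mul0r addr0 /wronsk /= mulr1 mul0r subr0.
have aa : al * rc (2 * ar) = al * al + 1.
  apply/eqP; rewrite eq_complex /=; apply/andP; split; apply/eqP.
    by rewrite -[X in _ = _ + X]norm1; ring.
  by ring.
rewrite det_mx2 !coupled_entry [RHS]mulrBr aa -[X in _ = _ + X - _]detPhi.
rewrite -[al * al in RHS]mulr1 -detC /discr /tr11 /tr22.
have [-> -> -> ->] := Phi_entries z.
move: (sol z (1, 0) N) (sol z (0, 1) N) (rc m11) (rc m12) (rc m21) (rc m22) (al).
by move=> [p1 p2] [s1 s2] a b c d e /=; ring.
Qed.

(** A kernel vector u satisfies Φ u = α M u, so the Wronskian of u and its conjugate is multiplied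
    by |α|^2 det M = 1 from 0 to N. *)
Lemma coupled_real z : \det (T z) = 0 -> complex.Im z = 0.
Proof.
move=> /kernel_vector[a [b [ab]]]; rewrite !coupled_entry => k0 k1.
apply: (selfadjoint_real z a b ab).
have E : sol z (a, b) N =
    (al * (rc m11 * a + rc m12 * b), al * (rc m21 * a + rc m22 * b)).
  have [p00 p10 p01 p11] := Phi_entries z.
  rewrite traj_comb -p00 -p10 -p01 -p11.
  congr (_, _); apply/eqP; rewrite -subr_eq0 -oppr_eq0; apply/eqP.
    by rewrite -[RHS]k0; ring.
  by rewrite -[RHS]k1; ring.
have cE m n : conjc (al * (rc m * a + rc n * b)) =
    conjc al * (rc m * conjc a + rc n * conjc b).
  by rewrite rmorphM rmorphD !rmorphM; congr (_ * (_ * _ + _ * _)); apply: conjc_rc.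
have wE (u v u' v' : C) : wronsk (u, v) (u', v') = u * v' - v * u' by [].
rewrite conjc_sol E !wE !cE.
have detC : rc m11 * rc m22 - rc m12 * rc m21 = 1.
  by rewrite !rcE -!rmorphM -rmorphB /= dM rmorph1.
rewrite -[RHS]mul1r -detC -[RHS]mul1r -unit_mul_conj.
move: (al) (conjc al) (rc m11) (rc m12) (rc m21) (rc m22) (conjc a) (conjc b).
by move=> *; ring.
Qed.

Lemma cdiscr_root z : (root (map_poly (real_complex R)
    (discr_poly R g q w m11 m12 m21 m22 N - (2 * ar)%:P)) z) = (\det (T z) == 0).
Proof.
rewrite /root rmorphB /= map_polyC hornerD hornerN hornerC.
rewrite horner_map_discr_poly det_coupled mulf_eq0.
have -> : (al == 0) = false.
  apply/eqP => a0; have := unit_mul_conj; rewrite a0 mul0r => /esym/eqP.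
  by rewrite oner_eq0.
by rewrite /= subr_eq0 eq_sym -subr_eq0.
Qed.


Lemma sol_rc (x : R) (a b : R) n : sol (rc x) (rc a, rc b) n =
  (rc (traj g q w x (a, b) n).1, rc (traj g q w x (a, b) n).2).
Proof. exact: (traj_morph _ _ (real_complex R)). Qed.

Lemma Phi_rc (x : R) :
  [/\ Phi (rc x) 0 0 = rc (traj g q w x (1, 0) N).1,
      Phi (rc x) 1 0 = rc (traj g q w x (1, 0) N).2,
      Phi (rc x) 0 1 = rc (traj g q w x (0, 1) N).1 &
      Phi (rc x) 1 1 = rc (traj g q w x (0, 1) N).2].
Proof.
have [-> -> -> ->] := Phi_entries (rc x).
by have /= -> := sol_rc x 1 0 N; have /= -> := sol_rc x 0 1 N.
Qed.

Lemma cdiscr_rc (x : R) : cdiscr (rc x) = rc (discr g q w m11 m12 m21 m22 N x).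
Proof. exact: (discr_morph _ _ (real_complex R)). Qed.

Local Notation ra x := (tr11 g q w m12 m22 N x).
Local Notation rb x := (tr12 g q w m12 m22 N x).
Local Notation rcc x := (tr21 g q w m11 m21 N x).
Local Notation rd x := (tr22 g q w m11 m21 N x).

(** Φ(x) and M are real, so α M = Φ(x) forces α real, and then P(x) = α I. *)
Lemma coupled_eq0 (x : R) : T (rc x) = 0 <->
  [/\ ai = 0, ra x = ar, rb x = 0, rcc x = 0 & rd x = ar].
Proof.
have [P1 P2 P3 P4] := Phi_rc x.
rewrite /tr11 /tr12 /tr21 /tr22.
move: P1 P2 P3 P4; case: (traj g q w x (1, 0) N) => p1 p2 /=.
case: (traj g q w x (0, 1) N) => s1 s2 /= P1 P2 P3 P4.
split=> [T0|[ai0 ea eb ec ed]].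
  have ent i j : al * rc (M i j) = Phi (rc x) i j.
    by apply/eqP; rewrite -subr_eq0 -coupled_entry T0 mxE.
  have := ent 0 0; rewrite P1 => -[]; rewrite !mulr0 subr0 add0r => e1 i1.
  have := ent 1 0; rewrite P2 => -[]; rewrite !mulr0 subr0 add0r => e2 i2.
  have := ent 0 1; rewrite P3 => -[]; rewrite !mulr0 subr0 add0r => e3 i3.
  have := ent 1 1; rewrite P4 => -[]; rewrite !mulr0 subr0 add0r => e4 i4.
  rewrite -e1 -e2 -e3 -e4; split; try by ring.
  - transitivity (ai * m11 * m22 - ai * m12 * m21); last by rewrite i1 i3; ring.
    by rewrite -[LHS]mulr1 -dM; ring.
  - by rewrite -[RHS]mulr1 -dM; ring.
  - by rewrite -[RHS]mulr1 -dM; ring.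
have e1 : ar * m11 = p1.
  transitivity (m11 * (m22 * p1 - m12 * p2) + m12 * (m11 * p2 - m21 * p1)).
    by rewrite ea ec; ring.
  by rewrite -[RHS]mul1r -dM; ring.
have e2 : ar * m21 = p2.
  transitivity (m21 * (m22 * p1 - m12 * p2) + m22 * (m11 * p2 - m21 * p1)).
    by rewrite ea ec; ring.
  by rewrite -[RHS]mul1r -dM; ring.
have e3 : ar * m12 = s1.
  transitivity (m11 * (m22 * s1 - m12 * s2) + m12 * (m11 * s2 - m21 * s1)).
    by rewrite eb ed; ring.
  by rewrite -[RHS]mul1r -dM; ring.
have e4 : ar * m22 = s2.
  transitivity (m21 * (m22 * s1 - m12 * s2) + m22 * (m11 * s2 - m21 * s1)).
    by rewrite eb ed; ring.
  by rewrite -[RHS]mul1r -dM; ring.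
have rcM (m : R) : al * rc m = rc (ar * m).
  by apply/eqP; rewrite eq_complex /= ai0; apply/andP; split; apply/eqP; ring.
apply: mx2P; rewrite coupled_entry [RHS]mxE rcM.
all: by rewrite ?P1 ?P2 ?P3 ?P4 ?e1 ?e2 ?e3 ?e4 subrr.
Qed.

(** Algebraic and geometric multiplicities agree: T = 0 goes with a double root, T of rank one with
    a simple root. *)
Lemma coupled_mult (x : R) : exists2 r : {poly R},
  discr_poly R g q w m11 m12 m21 m22 N - (2 * ar)%:P =
  ('X - x%:P) ^+ sl_mult N f q w (al *: cmx M) (-1) (rc x) * r & r.[x] != 0.
Proof.
rewrite sl_multE // rank_mx2.
have detE : (\det (T (rc x)) == 0) = (discr g q w m11 m12 m21 m22 N x == 2 * ar).
  rewrite -cdiscr_root /root rmorphB /= map_polyC hornerD hornerN hornerC.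
  rewrite horner_map_discr_poly [discr _ _ _ _ _ _ _ _ _]cdiscr_rc.
  by rewrite !rcE -rmorphB /= fmorph_eq0 subr_eq0.
have [Dx|Dx] := eqVneq (discr g q w m11 m12 m21 m22 N x) (2 * ar); last first.
  have T0 : (T (rc x) == 0) = false.
    by apply: contraNF Dx => /eqP T0; rewrite -detE T0 det0.
  rewrite T0 detE (negbTE Dx) /= expr0.
  exists (discr_poly R g q w m11 m12 m21 m22 N - (2 * ar)%:P); first by rewrite mul1r.
  by rewrite hornerD hornerN hornerC horner_discr_poly subr_eq0.
have g1 : (f 1%N)^-1 != 0 by rewrite invr_eq0 f0 //; lia.
have [r rE rx] := discr_poly_factor R g q w m11 m12 m21 m22 N dM x.
have [T0|T0] := eqVneq (T (rc x)) 0.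
  have [ai0 ea eb ec ed] := (coupled_eq0 x).1 T0.
  have ar2 : ar ^+ 2 = 1 by rewrite -norm1 ai0; ring.
  have [r2 r2E r2x] :=
    discr_poly_factor2 R g q w m11 m12 m21 m22 N dM x ar ar2 ea ed eb ec.
  exists r2; first by rewrite mulr_natl.
  rewrite r2x mulf_eq0 negb_or [X in _ && ~~ X]gt_eqF ?gram_det_gt0 // andbT oppr_eq0.
  by apply/eqP => a0; move: ar2; rewrite a0 expr0n /= => /esym/eqP; rewrite oner_eq0.
rewrite detE Dx eqxx expr1; exists r; first by rewrite -rE Dx.
(* A vanishing derivative would make P(x) scalar by [transfer_scalar], and hence T zero. *)
rewrite rx oppr_eq0; apply: contraNneq T0 => E0.
have D4 : discr g q w m11 m12 m21 m22 N x ^+ 2 <= 4.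
  by rewrite Dx exprMn; have := sqr_ge0 ai; move: norm1; lra.
have [eb ec ead] := transfer_scalar R g q w m11 m12 m21 m22 N N2 g1 wpos dM x D4 E0.
have ea : ra x = ar by move: Dx; rewrite /discr -ead; lra.
apply/eqP/coupled_eq0; split=> //; last by rewrite -ead.
(* The determinant of P(x) = ar I gives ar^2 = 1, so ai = 0. *)
have := transfer_det R g q w m11 m12 m21 m22 N dM x; rewrite -ead ea eb mulr0 subr0.
rewrite -expr2 => aa; apply/eqP; rewrite -sqrf_eq0; apply/eqP.
by move: norm1; rewrite aa; lra.
Qed.

End Coupled.

(** * The decoupled condition and the eigenvalue lists *)

Local Notation ctr21 z := (tr21 cg cq cw (rc m11) (rc m21) N z).

(** The first row imposes f_0 Δy_0 = 0, so only multiples of the solution with data (1, 0) remain,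
    and the second row tests P_21. *)
Lemma decoupled_mult z :
  sl_mult N f q w (@TK_A R) (TK_B M) z = (ctr21 z == 0 : nat).
Proof.
rewrite sl_multE // rank_mx2; set T := (_ + _ *m _)%R.
have T00 : T 0 0 = 0 by rewrite !mxE sum_ord2 !mxE /=; ring.
have T01 : T 0 1 = 1 by rewrite !mxE sum_ord2 !mxE /=; ring.
have T10 : T 1 0 = ctr21 z.
  have [p00 p10 _ _] := Phi_entries z.
  rewrite /tr21 -p00 -p10 /T mxE [(_ *m _) 1 0]mxE sum_ord2 /TK_A /TK_B !mxE /=.
  by rewrite rcE rmorphN /= -rcE add0r addrC mulNr.
have Tn0 : (T == 0) = false.
  by apply/eqP => /matrixP/(_ 0 1); rewrite T01 mxE => /eqP; rewrite oner_eq0.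
by rewrite Tn0 det_mx2 T00 T01 T10 mul0r mul1r sub0r oppr_eq0.
Qed.

(** The end data and their conjugate are both proportional to the nonzero real vector (m11, m21), so
    their Wronskian vanishes, as it does for the initial data (1, 0). *)
Lemma decoupled_real z : ctr21 z = 0 -> complex.Im z = 0.
Proof.
rewrite /tr21 => /eqP; rewrite subr_eq0 => /eqP E.
apply: (selfadjoint_real z 1 0) => [[/eqP]|]; first by rewrite oner_eq0.
have w0 : wronsk (1, 0) (conjc 1, conjc 0) = 0 :> C.
  by rewrite /wronsk conjc0 mulr0 mul0r subrr.
rewrite conjc_sol {}w0; move: E; case: (sol z (1, 0) N) => p1 p2 E.
have {}E : rc m11 * p2 = rc m21 * p1 := E.
have E' : rc m11 * conjc p2 = rc m21 * conjc p1.
  have cM (m : R) p : conjc (rc m * p) = rc m * conjc p.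
    by rewrite rmorphM; congr (_ * _); apply: conjc_rc.
  by have := congr1 (@conjc R) E; rewrite !cM.
change (p1 * conjc p2 - p2 * conjc p1 = 0).
apply/eqP; apply: contraT => Wn0.
have W1 : rc m11 * (p1 * conjc p2 - p2 * conjc p1) = 0.
  transitivity (p1 * (rc m11 * conjc p2) - (rc m11 * p2) * conjc p1); first by ring.
  by rewrite E E'; ring.
have W2 : rc m21 * (p1 * conjc p2 - p2 * conjc p1) = 0.
  transitivity ((rc m21 * p1) * conjc p2 - p2 * (rc m21 * conjc p1)); first by ring.
  by rewrite -E -E'; ring.
move/eqP: W1; rewrite mulf_eq0 (negbTE Wn0) orbF rcE fmorph_eq0 => /eqP m0.
move/eqP: W2; rewrite mulf_eq0 (negbTE Wn0) orbF rcE fmorph_eq0 => /eqP m0'.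
by move: dM; rewrite m0 m0' mul0r mulr0 subr0 => /eqP; rewrite eq_sym oner_eq0.
Qed.

Lemma ctr21_rc (x : R) : ctr21 (rc x) = rc (tr21 g q w m11 m21 N x).
Proof. exact: (tr21_morph _ _ (real_complex R)). Qed.

Lemma ctr21_root z :
  root (map_poly (real_complex R) (tr21_poly R g q w m11 m21 N)) z = (ctr21 z == 0).
Proof. by rewrite /root horner_map_tr21_poly. Qed.

Let g1 : (f 1%N)^-1 != 0. Proof. by rewrite invr_eq0 f0 //; lia. Qed.

Lemma tr22_neq0 x : tr21 g q w m11 m21 N x = 0 -> tr22 g q w m11 m21 N x != 0.
Proof.
move=> c0; have := transfer_det R g q w m11 m12 m21 m22 N dM x.
rewrite c0 mul0r subr0 => ad; apply/eqP => d0; move: ad; rewrite d0 mulr0.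
by move=> /eqP; rewrite eq_sym oner_eq0.
Qed.

Lemma decoupled_factor (x : R) : exists2 r : {poly R},
  tr21_poly R g q w m11 m21 N =
  ('X - x%:P) ^+ sl_mult N f q w (@TK_A R) (TK_B M) (rc x) * r & r.[x] != 0.
Proof.
rewrite decoupled_mult ctr21_rc rcE fmorph_eq0.
have [c0|c0] := eqVneq (tr21 g q w m11 m21 N x) 0; last first.
  by exists (tr21_poly R g q w m11 m21 N); rewrite ?expr0 ?mul1r ?horner_tr21_poly.
have [r rE rx] := tr21_poly_factor R g q w m11 m12 m21 m22 N dM x c0.
exists r; first by rewrite expr1.
rewrite rx oppr_eq0 mulf_neq0 ?tr22_neq0 // gt_eqF // gram_gt0 //.
by move=> [/eqP]; rewrite oner_eq0.
Qed.

(** Common to both kinds of condition: when the root orders of [p] are the geometric multiplicities,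
    its sorted root list is the eigenvalue list. *)
Lemma sl_eigs_split A B (p : {poly R}) : p != 0 ->
  (forall z, (0 < sl_mult N f q w A B z)%N =
     root (map_poly (real_complex R) p) z) ->
  (forall z, root (map_poly (real_complex R) p) z -> complex.Im z = 0) ->
  (forall x : R, exists2 r : {poly R},
     p = ('X - x%:P) ^+ sl_mult N f q w A B (rc x) * r & r.[x] != 0) ->
  [/\ sorted <=%R (sl_eigs N f q w A B),
      forall x, count_mem x (sl_eigs N f q w A B) = sl_mult N f q w A B (rc x),
      p = lead_coef p *: \prod_(x <- sl_eigs N f q w A B) ('X - x%:P) &
      size (sl_eigs N f q w A B) = (size p).-1].
Proof.
move=> p0 mE im0 fac.
have [L sL pL] := real_rooted_split R p p0 im0.
have lc0 : lead_coef p != 0 by rewrite lead_coef_eq0.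
have cL x : count_mem x L = sl_mult N f q w A B (rc x).
  by have [r rE rx] := fac x; apply: (count_mem_split _ _ _ _ _ _ _ lc0 pL rE rx).
have -> : sl_eigs N f q w A B = L.
  by apply: sl_eigs_unique; split=> //; split=> // z; rewrite mE; apply: im0.
by split=> //; rewrite pL size_scale // size_prod_XsubC.
Qed.

End Boundary.

(** * Spectra *)

(** Factors are turned into x - t, the form used by the interlacing lemmas; the first two factors
    together carry the sign at -oo. *)
Lemma horner_split (F : fieldType) (p : {poly F}) (L : seq F) t :
  p = lead_coef p *: \prod_(x <- L) ('X - x%:P) ->
  p.[t] = lead_coef p * (-1) ^+ size L * \prod_(x <- L) (x - t).
Proof.
move=> {1}->; rewrite hornerZ horner_prod -mulrA; congr (_ * _).
elim: L => [|x L IH]; first by rewrite !big_nil mulr1.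
by rewrite !big_cons IH hornerXsubC /= exprS; ring.
Qed.

Lemma unit_circle_le (R : realFieldType) (x y : R) :
  x ^+ 2 + y ^+ 2 = 1 -> - 1 <= x <= 1.
Proof. by move=> h; have h' := sqr_ge0 y; apply/andP; split; nra. Qed.

Lemma unit_circle_lt (R : realFieldType) (x y : R) :
  x ^+ 2 + y ^+ 2 = 1 -> y != 0 -> - 1 < x < 1.
Proof.
rewrite -sqrf_eq0 => h y0; have h' : 0 < y ^+ 2 by rewrite lt_def y0 sqr_ge0.
by apply/andP; split; nra.
Qed.

Lemma sign_discr_ge0 (R : realFieldType) n (d a : R) : - 1 <= a <= 1 ->
  2 <= (-1) ^+ n * d -> 0 <= (-1) ^+ n * (d - 2 * a).
Proof.
by rewrite -signr_odd; case: odd => /andP[]; rewrite ?expr1 ?expr0 ?mul1r ?mulN1r; lra.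
Qed.

Lemma discr_level_lt (R : realFieldType) (a : R) : - 1 < a < 1 ->
  2 * a - 2 * 1 < 0 /\ 0 < 2 * a - 2 * -1.
Proof. by move=> /andP[]; lra. Qed.

Lemma sign_of_pos (R : realFieldType) (k a : R) :
  0 < k * a -> 0 < a -> 0 < (-1) ^+ false * k.
Proof. by move=> ka a0; rewrite mul1r -(pmulr_lgt0 _ a0). Qed.

Lemma sign_of_neg (R : realFieldType) (k a : R) :
  0 < k * a -> a < 0 -> 0 < (-1) ^+ true * k.
Proof. by move=> ka a0; rewrite mulN1r oppr_gt0 -(nmulr_lgt0 _ a0). Qed.

Section Spectra.
Variables (R : realType) (N : nat) (f q w : nat -> R) (M : 'M[R]_2).
Hypothesis N2 : (2 <= N)%N.
Hypothesis f0 : forall n, (n <= N)%N -> f n != 0.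
Hypothesis wpos : forall n, (1 <= n <= N)%N -> 0 < w n.
Hypothesis prodf : 0 < \prod_(i < N) (f i)^-1.
Hypothesis detM : \det M = 1.

Local Notation g := (fun i => (f i)^-1).
Local Notation m11 := (M 0 0).
Local Notation m12 := (M 0 1).
Local Notation m21 := (M 1 0).
Local Notation m22 := (M 1 1).
Local Notation D := (discr g q w m11 m12 m21 m22 N).
Local Notation Dp := (discr_poly R g q w m11 m12 m21 m22 N).
Local Notation Gp := (tr21_poly R g q w m11 m21 N).
Local Notation mu := (sl_eigs N f q w (@TK_A R) (TK_B M)).
Local Notation eigs al := (sl_eigs N f q w (al *: cmx M) (-1)).

Let dM : m11 * m22 - m12 * m21 = 1. Proof. by rewrite -det_mx2. Qed.

(** The factor 1/f_0 completes the product over 1/f_1, ..., 1/f_n to the one assumed positive. *)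
Lemma lead_traj_sign n : N = n.+1 ->
  0 < (-1) ^+ n * (f 0%N)^-1 * lead_traj R g w n.
Proof.
move=> Nn; move: prodf; rewrite Nn big_ord_recl /= /lead_traj => h.
under eq_bigr do rewrite mulNr -mulN1r.
rewrite big_split /= big_split /= prodr_const card_ord.
set s := (-1) ^+ n; have ss : s * s = 1 by rewrite /s -expr2 sqrr_sign.
have wp : 0 < \prod_(i < n) w i.+1.
  by apply: prodr_gt0 => i _; apply: wpos => /=; have := ltn_ord i; lia.
have := mulr_gt0 wp h.
set P := \prod_(i < _) w _; set Q := \prod_(i < _) (f _)^-1.
have -> : s * (f 0%N)^-1 * (s * (P * Q)) = (s * s) * (P * ((f 0%N)^-1 * Q)) by ring.
by rewrite ss mul1r.
Qed.

Let pN : N = N.-1.+1. Proof. by rewrite prednK // ltnW. Qed.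

Lemma size_coef (p : {poly R}) n : (forall j, (n < j)%N -> p`_j = 0) ->
  p`_n != 0 -> size p = n.+1 /\ lead_coef p = p`_n.
Proof.
move=> h pn; have sz : size p = n.+1.
  apply/eqP; rewrite eqn_leq; apply/andP; split; first exact/leq_sizeP.
  by rewrite ltnNge; apply/negP => /leq_sizeP/(_ n (leqnn n)) /eqP; rewrite (negbTE pn).
by rewrite lead_coefE sz.
Qed.

(** Here k is (-1)^N times the leading coefficient; its positivity means that tr P tends to +oo at
    -oo. *)
Lemma coupled_spectrum (ar ai : R) : 0 < m11 - f 0%N * m12 ->
  ar ^+ 2 + ai ^+ 2 = 1 -> let L := eigs (Complex ar ai) in
  [/\ sorted <=%R L, size L = N &
      exists2 k, 0 < k & forall t, D t - 2 * ar = k * \prod_(x <- L) (x - t)].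
Proof.
move=> mpos norm1 L.
have [cz cN] := coef_discr_poly R g q w m11 m12 m21 m22 N N.-1 pN.
have lpos : 0 < (-1) ^+ N * Dp`_N.
  rewrite cN {1}pN exprS.
  have -> : m11 * (f 0%N)^-1 - m12 = (f 0%N)^-1 * (m11 - f 0%N * m12).
    by field; apply: f0.
  have := mulr_gt0 (mulr_gt0 (lead_traj_sign _ pN) mpos) (wpos N ltac:(lia)).
  by congr (0 < _); ring.
set p := Dp - (2 * ar)%:P.
have pc j : (0 < j)%N -> p`_j = Dp`_j.
  by move=> j0; rewrite coefB coefC; case: j j0 => //= j _; rewrite subr0.
have [szp lcp] : size p = N.+1 /\ lead_coef p = Dp`_N.
  rewrite -(pc N) ?(ltnW N2) //; apply: size_coef => [j jN|].
    by rewrite pc ?cz //; lia.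
  rewrite pc ?(ltnW N2) //; apply/eqP => z; by rewrite z mulr0 ltxx in lpos.
have p0 : p != 0 by rewrite -size_poly_eq0 szp.
have rE z := cdiscr_root R N f q w M detM ar ai norm1 z.
have [||| sL cL pL szL] := sl_eigs_split R N f q w (Complex ar ai *: cmx M) (-1) p p0.
- move=> z; rewrite rE sl_multE // rank_mx2.
  by case: eqP => [->|_]; rewrite ?det0 ?eqxx ?lt0b.
- by move=> z; rewrite rE => /eqP; apply: coupled_real.
- by move=> x; apply: coupled_mult.
split=> //; first by rewrite szL szp.
exists ((-1) ^+ N * Dp`_N) => // t.
rewrite -horner_discr_poly -[2 * ar in LHS](hornerC _ t) -hornerN -hornerD -/p.
by rewrite (horner_split _ _ _ t pL) lcp szL szp /=; congr (_ * _); rewrite mulrC.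
Qed.

Lemma decoupled_spectrum : Gp != 0 ->
  [/\ sorted <%R mu, size mu = (size Gp).-1 &
      Gp = lead_coef Gp *: \prod_(x <- mu) ('X - x%:P)].
Proof.
move=> p0.
have [||| sL cL pL szL] := sl_eigs_split R N f q w (@TK_A R) (TK_B M) Gp p0.
- by move=> z; rewrite ctr21_root decoupled_mult // lt0b.
- by move=> z; rewrite ctr21_root => /eqP; apply: decoupled_real.
- by move=> x; apply: decoupled_factor.
split=> //; rewrite lt_sorted_uniq_le sL andbT; apply: count_mem_uniq => x.
by rewrite -[x \in _]has_pred1 has_count cL decoupled_mult // lt0b.
Qed.

(* At a zero of the (2,1) entry, M^-1 Phi is triangular with diagonal (1/d, d),
   and the derivative of that entry there has the sign of -d. *)
Lemma discr_at_decoupled (e : bool) i : Gp != 0 ->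
  0 < (-1) ^+ e * (lead_coef Gp * (-1) ^+ size mu) -> (i < size mu)%N ->
  2 <= (-1) ^+ (i + e) * D (nth 0 mu i).
Proof.
move=> G0 kpos imu; have [smu szmu GE] := decoupled_spectrum G0.
set x := nth 0 mu i; have xmu : x \in mu by exact: mem_nth.
have c0 : tr21 g q w m11 m21 N x = 0.
  rewrite -horner_tr21_poly; apply/rootP.
  by rewrite GE rootZ ?lead_coef_eq0 // root_prod_XsubC.
(* The cofactor of X - x is computed twice: from the factorization over mu, and as -d S11 at x.
   Comparing them gives the sign of d. *)
have [r rE rx] := tr21_poly_factor R g q w m11 m12 m21 m22 N dM x c0.
have rmu : r = lead_coef Gp *: \prod_(y <- rem x mu) ('X - y%:P).
  have Xx : 'X - x%:P != 0 :> {poly R} by rewrite polyXsubC_eq0.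
  apply: (mulfI Xx); rewrite -rE {1}GE (big_rem x xmu) /=.
  by rewrite scalerAr.
have umu : uniq mu by exact: lt_sorted_uniq.
have sz1 : size mu = (size (rem x mu)).+1.
  by rewrite size_rem // prednK // (leq_ltn_trans (leq0n i) imu).
have dE : tr22 g q w m11 m21 N x * gram g q w x x (1, 0) (1, 0) N =
    lead_coef Gp * (-1) ^+ size mu * \prod_(y <- rem x mu) (y - x).
  apply: oppr_inj; rewrite -rx rmu hornerZ sz1 exprS mulN1r mulrN mulNr opprK -mulrA.
  congr (_ * _).
  have := horner_split R (\prod_(y <- rem x mu) ('X - y%:P)) (rem x mu) x.
  have /eqP -> : \prod_(y <- rem x mu) ('X - y%:P) \is monic by exact: monic_prod_XsubC.
  by rewrite scale1r mul1r; apply.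
have S11 : 0 < gram g q w x x (1, 0) (1, 0) N.
  apply: gram_gt0 => //; first by rewrite invr_eq0 f0 //; lia.
  by move=> [/eqP]; rewrite oner_eq0.
have := prod_sub_sign R (rem x mu) x; rewrite mem_rem_uniqF // => /(_ isT).
have -> : count (fun y => y < x) (rem x mu) = i.
  rewrite -[RHS](count_lt_nth 0 smu imu) -/x.
  by rewrite (permP (perm_to_rem xmu)) /= ltxx.
move=> sgn.
have := transfer_det R g q w m11 m12 m21 m22 N dM x; rewrite c0 mul0r subr0.
have {sgn kpos} := mulr_gt0 kpos sgn.
set s := (-1) ^+ e; set s' := (-1) ^+ i; set k := _ * (-1) ^+ size mu in dE *.
have -> : s * k * (s' * \prod_(y <- rem x mu) (y - x)) =
    s' * s * (k * \prod_(y <- rem x mu) (y - x)) by ring.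
rewrite -dE mulrA pmulr_lgt0 // /s' /s -exprD /discr.
set t := (-1) ^+ (i + e); have tt : t * t = 1 by rewrite /t -expr2 sqrr_sign.
move: (tr11 _ _ _ _ _ _ _) (tr22 _ _ _ _ _ _ _) => a d td ad.
(* Two positive numbers with product 1 have sum at least 2. *)
have : (t * a) * (t * d) = 1 by rewrite -[RHS]tt -[RHS]mulr1 -ad; ring.
rewrite mulrDr; move: (t * a) (t * d) td => u v v0 uv.
have := sqr_ge0 (u - v); nra.
Qed.

(** [e] records the sign (-1)^e of P_21 at -oo. As |2 Re α| <= 2, the sign of tr P at mu_i is kept,
    weakly, by tr P - 2 Re α. *)
Lemma coupled_interlaces (e : bool) (ar ai : R) : 0 < m11 - f 0%N * m12 ->
  ar ^+ 2 + ai ^+ 2 = 1 -> Gp != 0 ->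
  0 < (-1) ^+ e * (lead_coef Gp * (-1) ^+ size mu) -> (N <= size mu + e)%N ->
  interlaces R e mu (eigs (Complex ar ai)).
Proof.
move=> mpos norm1 G0 kpos szN.
have [sL szL [k k0 kE]] := coupled_spectrum ar ai mpos norm1.
have [smu _ _] := decoupled_spectrum G0.
have dmu i (imu : (i < size mu)%N) :=
  sign_discr_ge0 _ _ _ _ (unit_circle_le _ _ _ norm1)
    (discr_at_decoupled e i G0 kpos imu).
move: (mu) (eigs _) smu szN dmu sL szL kE => nu L snu szN dnu sL szL kE.
apply: (alternating_interlaces _ _ _ _ snu) => [|i inu]; first by rewrite szL.
by rewrite -(pmulr_rge0 _ k0) mulrCA -kE; apply: dnu.
Qed.

Lemma eigs_one : sl_eigs N f q w (cmx M) (-1) = eigs (Complex 1 0).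
Proof. by rewrite scale1r. Qed.

Lemma eigs_opp : sl_eigs N f q w (cmx (- M)) (-1) = eigs (Complex (-1) 0).
Proof.
have -> // : cmx (- M) = Complex (-1) 0 *: cmx M.
apply/matrixP => a b; rewrite !mxE; apply/eqP; rewrite eq_complex /=.
by apply/andP; split; apply/eqP; ring.
Qed.

Lemma coupled_propP (e : bool) (gam : R) : 0 < m11 - f 0%N * m12 -> Gp != 0 ->
  0 < (-1) ^+ e * (lead_coef Gp * (-1) ^+ size mu) -> (N <= size mu + e)%N ->
  (- pi < gam < 0) \/ (0 < gam < pi) -> propP N f q w M gam.
Proof.
move=> mpos G0 kpos szN hgam j jN.
have n1 : cos gam ^+ 2 + sin gam ^+ 2 = 1 by exact: cos2Dsin2.
(* The range of γ excludes the zeros of the sine. *)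
have c1 : - 1 < cos gam < 1.
  apply: (unit_circle_lt _ _ _ n1).
  case: hgam => h; last by rewrite gt_eqF // sin_gt0_pi.
  rewrite -[gam]opprK sinN oppr_eq0 gt_eqF // sin_gt0_pi //.
  by move/andP: h => [h1 h2]; rewrite oppr_gt0 h2 ltrNl h1.
have np : 1 ^+ 2 + 0 ^+ 2 = 1 :> R by ring.
have nm : (-1) ^+ 2 + 0 ^+ 2 = 1 :> R by ring.
have [s1 z1 [k1 k1p k1E]] := coupled_spectrum 1 0 mpos np.
have [s2 z2 [k2 k2p k2E]] := coupled_spectrum (-1) 0 mpos nm.
have [s3 z3 [k3 k3p k3E]] := coupled_spectrum (cos gam) (sin gam) mpos n1.
have i1 := coupled_interlaces e 1 0 mpos np G0 kpos szN.
have i2 := coupled_interlaces e (-1) 0 mpos nm G0 kpos szN.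
have i3 := coupled_interlaces e (cos gam) (sin gam) mpos n1 G0 kpos szN.
have Dsgn := discr_level_lt _ _ c1.
rewrite /sl_lam eigs_one eigs_opp -/(cexpi gam) /=.
move: (mu) (eigs (Complex 1 0)) (eigs (Complex (-1) 0)) (eigs (cexpi gam))
  szN s1 z1 k1E s2 z2 k2E s3 z3 k3E i1 i2 i3.
move=> nu L1 L2 L3 szN s1 z1 k1E s2 z2 k2E s3 z3 k3E i1 i2 i3.
have jlt : (j < size L3)%N by rewrite z3 pN ltnS.
set x := nth 0 L3 j.
have Dx : D x = 2 * cos gam.
  have := k3E x; rewrite (big_rem x) ?mem_nth //= subrr mul0r mulr0.
  by move/eqP; rewrite subr_eq0 => /eqP.
(* [true] and [false] encode the signs of 2 cos γ - 2 and 2 cos γ + 2, the values at x of tr P - 2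
   and tr P + 2. *)
have b1 : 0 < (-1) ^+ true * \prod_(y <- L1) (y - x).
  by rewrite -(pmulr_rgt0 _ k1p) mulrCA -k1E Dx expr1 mulN1r oppr_gt0; case: Dsgn.
have b2 : 0 < (-1) ^+ false * \prod_(y <- L2) (y - x).
  by rewrite -(pmulr_rgt0 _ k2p) mulrCA -k2E Dx expr0 mul1r; case: Dsgn.
have szL1 : size L1 = size L3 by rewrite z1 z3.
have szL2 : size L2 = size L3 by rewrite z2 z3.
have szmu : (size L3 <= size nu + e)%N by rewrite z3.
have := interlaces_compare R e nu _ _ j true s1 s3 i1 i3 szL1 szmu jlt b1.
have := interlaces_compare R e nu _ _ j false s2 s3 i2 i3 szL2 szmu jlt b2.
by case: (odd j) => h2 h1; apply/andP; split.
Qed.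

(** Interlacing for α = 1 and α = -1; the shift by [e] separates case (i) from cases (ii) and
    (iii). *)
Lemma coupled_decoupled_le (e : bool) : 0 < m11 - f 0%N * m12 -> Gp != 0 ->
  0 < (-1) ^+ e * (lead_coef Gp * (-1) ^+ size mu) -> (N <= size mu + e)%N ->
  let lM := sl_lam N f q w (cmx M) (-1) in
  let lmM := sl_lam N f q w (cmx (- M)) (-1) in
  let lT := sl_lam N f q w (@TK_A R) (TK_B M) in
  (forall j, (j < size mu)%N -> (j + e < N)%N ->
     lT j <= Num.min (lM (j + e)%N) (lmM (j + e)%N)) /\
  (forall i j, (i < size mu)%N -> (j < i + e)%N ->
     Num.max (lM j) (lmM j) <= lT i).
Proof.
move=> mpos G0 kpos szN; rewrite /sl_lam eigs_one eigs_opp /=.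
have np : 1 ^+ 2 + 0 ^+ 2 = 1 :> R by ring.
have nm : (-1) ^+ 2 + 0 ^+ 2 = 1 :> R by ring.
have [s1 z1 _] := coupled_spectrum 1 0 mpos np.
have [s2 z2 _] := coupled_spectrum (-1) 0 mpos nm.
have i1 := coupled_interlaces e 1 0 mpos np G0 kpos szN.
have i2 := coupled_interlaces e (-1) 0 mpos nm G0 kpos szN.
move: (mu) (eigs (Complex 1 0)) (eigs (Complex (-1) 0)) s1 z1 s2 z2 i1 i2.
move=> nu L1 L2 s1 z1 s2 z2 i1 i2; split=> [j jmu jN|i j imu ji].
  by rewrite le_min !(interlaces_le_nth R e) ?z1 ?z2.
by rewrite ge_max !(interlaces_nth_le R e nu).
Qed.

(** The sign of P_21 at -oo is that of f_0 m11, which decides [e]. *)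
Lemma decoupled_lead : m11 != 0 ->
  [/\ Gp != 0, size mu = N & 0 < (lead_coef Gp * (-1) ^+ size mu) * (f 0%N * m11)].
Proof.
move=> m0; have [cz cN _ _] := coef_tr21_poly R g q w m11 m21 N N.-1 pN.
have ltp := lead_traj_sign _ pN.
have lt0 : lead_traj R g w N.-1 != 0.
  by apply/eqP => z; rewrite z mulr0 ltxx in ltp.
have wN : 0 < w N by apply: wpos; rewrite leqnn (ltnW N2).
have [szG lcG] : size Gp = N.+1 /\ lead_coef Gp = Gp`_N.
  by apply: size_coef => //; rewrite cN !mulf_neq0 // oppr_eq0 gt_eqF.
have G0 : Gp != 0 by rewrite -size_poly_eq0 szG.
have [_ szmu _] := decoupled_spectrum G0.
rewrite szG /= in szmu; split=> //; rewrite szmu lcG cN.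
have -> : (-1) ^+ N = - (-1) ^+ N.-1 :> R by rewrite {1}pN exprS mulN1r.
have m2 : 0 < (f 0%N * m11) ^+ 2 by rewrite exprn_even_gt0 //= mulf_neq0 // f0.
have := mulr_gt0 (mulr_gt0 ltp wN) m2; congr (0 < _).
by field; apply: f0.
Qed.

(** Now -m21 m12 = 1, so the sign of the new leading coefficient can be read from m12. *)
Lemma decoupled_lead0 : m11 = 0 ->
  [/\ Gp != 0, size mu = N.-1 & 0 < (lead_coef Gp * (-1) ^+ size mu) * (f 0%N * m12)].
Proof.
move=> m0; have [_ _ /(_ m0) cz /(_ m0) cN] := coef_tr21_poly R g q w m11 m21 N N.-1 pN.
have ltp := lead_traj_sign _ pN.
have lt0 : lead_traj R g w N.-1 != 0.
  by apply/eqP => z; rewrite z mulr0 ltxx in ltp.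
have m1221 : - m21 * m12 = 1 by rewrite -dM m0; ring.
have m21n0 : m21 != 0.
  by apply/eqP => z; move/eqP: m1221; rewrite z oppr0 mul0r eq_sym oner_eq0.
have [szG lcG] : size Gp = N.-1.+1 /\ lead_coef Gp = Gp`_N.-1.
  by apply: size_coef => //; rewrite cN mulf_neq0 // oppr_eq0.
have G0 : Gp != 0 by rewrite -size_poly_eq0 szG.
have [_ szmu _] := decoupled_spectrum G0.
rewrite szG /= in szmu; split=> //; rewrite szmu lcG cN.
have f2 : 0 < f 0%N ^+ 2 by rewrite exprn_even_gt0 //= f0.
have := mulr_gt0 ltp f2; congr (0 < _).
by rewrite -[LHS]mulr1 -m1221; field; apply: f0.
Qed.

End Spectra.

(** Replacing K by -K only changes the sign of P_21, so the multiplicities coincide. *)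
Lemma decoupled_eigs_opp (R : realType) N (f q w : nat -> R) (K : 'M[R]_2) :
  (forall n, (n <= N)%N -> f n != 0) ->
  sl_eigs N f q w (@TK_A R) (TK_B (- K)) = sl_eigs N f q w (@TK_A R) (TK_B K).
Proof.
move=> f0.
have mE : sl_mult N f q w (@TK_A R) (TK_B (- K)) = sl_mult N f q w (@TK_A R) (TK_B K).
  apply/funext => z; rewrite !decoupled_mult // /tr21 !mxE.
  by rewrite !rcE !rmorphN /= !mulNr -opprD oppr_eq0.
by rewrite /sl_eigs /sl_eig_list mE.
Qed.

Theorem theorem3p10 (R : realType) (N : nat) (f q w : nat -> R)
  (K : 'M[R]_2) (g : R) :
  (2 <= N)%N ->
  (forall n, (n <= N)%N -> f n != 0) ->
  (forall n, (1 <= n <= N)%N -> 0 < w n) ->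
  0 < \prod_(i < N) (f i)^-1 ->
  ((- pi < g < 0) \/ (0 < g < pi)) ->
  \det K = 1 ->
  K 0 0 - f 0%N * K 0 1 != 0 ->
  forall M : 'M[R]_2, (M = K \/ M = - K) ->
  let lamT := sl_lam N f q w (@TK_A R) (TK_B K) in
  let lM := sl_lam N f q w (cmx M) (-1) in
  let lmM := sl_lam N f q w (cmx (- M)) (-1) in
  let mm := fun j => Num.min (lM j) (lmM j) in
  let MM := fun j => Num.max (lM j) (lmM j) in
  [/\ (0 < M 0 0 - f 0%N * M 0 1 -> 0 < f 0%N * M 0 0 ->
        [/\ propP N f q w M g,
            (forall j, (j <= N - 1)%N -> lamT j <= mm j) &
            (forall j, (j <= N - 2)%N -> MM j <= lamT j.+1)]),
      (0 < M 0 0 - f 0%N * M 0 1 -> f 0%N * M 0 0 < 0 ->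
        [/\ propP N f q w M g,
            (forall j, (j <= N - 2)%N -> MM j <= lamT j <= mm j.+1) &
            MM (N - 1)%N <= lamT (N - 1)%N]) &
      (f 0%N * M 0 1 < 0 -> M 0 0 = 0 ->
        propP N f q w M g /\
        (forall j, (j <= N - 2)%N -> MM j <= lamT j <= mm j.+1))].
Proof.
move=> N2.
have jN1 j : (j <= N - 1)%N -> (j < N)%N by lia.
have jN2 j : (j <= N - 2)%N -> (j.+1 < N)%N by lia.
have jN3 j : (j <= N - 2)%N -> (j < N.-1)%N by lia.
have Np : (N <= N.-1 + 1)%N by lia.
move=> f0 wpos prodf hg detK _ M MK lamT lM lmM mm MM.
have lamTE : lamT = sl_lam N f q w (@TK_A R) (TK_B M).
  by case: MK => ->; [|rewrite /lamT /sl_lam decoupled_eigs_opp].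
have detM : \det M = 1.
  by case: MK => ->; [|rewrite -detK !det_mx2 !mxE; ring].
pose mu := sl_eigs N f q w (@TK_A R) (TK_B M).
rewrite {}lamTE; split=> [mpos fm|mpos fm|fm m0].
(* Case (i): [e = false], with N decoupled eigenvalues. *)
- have m0 : M 0 0 != 0 by apply: contraTneq fm => ->; rewrite mulr0 ltxx.
  have [G0 szmu /sign_of_pos/(_ fm) kpos] :=
    decoupled_lead R N f q w M N2 f0 wpos prodf detM m0.
  have szN : (N <= size mu + false)%N by rewrite szmu addn0.
  have [lo up] :=
    coupled_decoupled_le R N f q w M N2 f0 wpos prodf detM false mpos G0 kpos szN.
  split=> [|j /jN1 jN|j /jN2 jN].
  + exact: (coupled_propP R N f q w M N2 f0 wpos prodf detM false).
  + by have := lo j; rewrite szmu addn0; apply.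
  + by apply: up; rewrite ?szmu ?addn0.
(* Case (ii): [e = true], again with N decoupled eigenvalues. *)
- have m0 : M 0 0 != 0 by apply: contraTneq fm => ->; rewrite mulr0 ltxx.
  have [G0 szmu /sign_of_neg/(_ fm) kpos] :=
    decoupled_lead R N f q w M N2 f0 wpos prodf detM m0.
  have szN : (N <= size mu + true)%N by rewrite szmu leq_addr.
  have [lo up] :=
    coupled_decoupled_le R N f q w M N2 f0 wpos prodf detM true mpos G0 kpos szN.
  split=> [|j /jN2 jN|].
  + exact: (coupled_propP R N f q w M N2 f0 wpos prodf detM true).
  + apply/andP; split; first by apply: up; rewrite ?szmu ?addn1 // ltnW.
    by have := lo j; rewrite szmu addn1; apply; rewrite // ltnW.
  + by apply: up; rewrite ?szmu ?addn1 ?jN1.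
(* Case (iii): [e = true], and N - 1 decoupled eigenvalues still suffice for N <= size mu + e. *)
have mpos : 0 < M 0 0 - f 0%N * M 0 1 by rewrite m0 sub0r oppr_gt0.
have [G0 szmu /sign_of_neg/(_ fm) kpos] :=
  decoupled_lead0 R N f q w M N2 f0 wpos prodf detM m0.
have szN : (N <= size mu + true)%N by rewrite szmu.
have [lo up] :=
    coupled_decoupled_le R N f q w M N2 f0 wpos prodf detM true mpos G0 kpos szN.
split=> [|j jN].
  exact: (coupled_propP R N f q w M N2 f0 wpos prodf detM true).
apply/andP; split; first by apply: up; rewrite ?szmu ?addn1 ?jN3.
by have := lo j; rewrite szmu addn1; apply; [apply: jN3 | apply: jN2].
Qed.
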